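(* There exists a deterministic non-oblivious local search algorithm that, given (value oracle access to) a non-negative monotone submodular function $f\colon 2^{\mathcal{N}}\to\mathbb{R}_{\ge0}$, a linear function $\ell\colon 2^{\mathcal{N}}\to\mathbb{R}$ and (independence oracle access to) a matroid $\mathcal{M}=(\mathcal{N},\mathcal{I})$, finds a set $S\in\mathcal{I}$ such that $f(S)+\ell(S)\ge(1-1/e-\varepsilon)\cdot f(OPT)+\ell(OPT)$ (for any $\varepsilon>0$ and any set $OPT\in\mathcal{I}$), using a query complexity of $\tilde{O}_\varepsilon(nr)$, where $r$ is the rank of $\mathcal{M}$ and $n=|\mathcal{N}|$. The query complexity can be improved to $\tilde{O}_\varepsilon(n+r\sqrt n)$ using randomization.
   Context: A linear function satisfies $\ell(S)=\sum_{u\in S}\ell(\{u\})$ (values may be negative). Monotone: $f(S)\le f(T)$ for $S\subseteq T$; submodular: $f(S)+f(T)\ge f(S\cap T)+f(S\cup T)$. $\tilde{O}_\varepsilon$ suppresses poly-logarithmic factors and factors depending only on $\varepsilon$. *)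

(* Defs.v *)
From HB Require Import structures.
From mathcomp Require Import all_boot all_order all_algebra.
From mathcomp Require Import reals sequences exp.

Set Implicit Arguments.
Unset Strict Implicit.
Unset Printing Implicit Defensive.

Import Order.TTheory GRing.Theory Num.Theory.

Local Open Scope ring_scope.

Section SetFunctions.
Variables (R : realType) (T : finType).
Implicit Types (g : {set T} -> R).

Definition setfun_nonneg g := forall S : {set T}, 0 <= g S.

Definition setfun_monotone g :=
  forall S U : {set T}, S \subset U -> g S <= g U.

Definition setfun_submodular g :=
  forall S U : {set T}, g (S :&: U) + g (S :|: U) <= g S + g U.

Definition setfun_linear g :=
  forall S : {set T}, g S = \sum_(u in S) g [set u].

End SetFunctions.

Record matroid (T : finType) := Matroid {
  indep : {set {set T}};
  indep_set0 : set0 \in indep;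
  indep_sub : forall S U : {set T}, S \subset U -> U \in indep -> S \in indep;
  indep_augment : forall S U : {set T}, S \in indep -> U \in indep ->
    (#|S| < #|U|)%N -> exists2 u, u \in U :\: S & u |: S \in indep
}.

Definition mrank (T : finType) (M : matroid T) : nat :=
  \max_(S in indep M) #|S|.

(* A deterministic query algorithm is its decision tree: computation between
   queries is free, and the function and the matroid can only be accessed
   through the answers to queries. *)
Inductive det_alg (R : Type) (T : finType) : Type :=
| Return of {set T}
| QueryValue of {set T} & (R -> det_alg R T)
| QueryIndep of {set T} & (bool -> det_alg R T).

Fixpoint output (R : Type) (T : finType) (f : {set T} -> R) (M : matroid T)
    (a : det_alg R T) : {set T} :=
  match a with
  | Return A => A
  | QueryValue A next => output f M (next (f A))
  | QueryIndep A next => output f M (next (A \in indep M))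
  end.

Fixpoint queries (R : Type) (T : finType) (f : {set T} -> R) (M : matroid T)
    (a : det_alg R T) : nat :=
  match a with
  | Return _ => 0
  | QueryValue A next => (queries f M (next (f A))).+1
  | QueryIndep A next => (queries f M (next (A \in indep M))).+1
  end.

(* A randomized query algorithm is a finitely supported distribution over
   deterministic ones; the seed holds all the random choices. *)
Record rand_alg (R : realType) (T : finType) := RandAlg {
  seed : finType;
  seed_prob : seed -> R;
  seed_prob_ge0 : forall w, 0 <= seed_prob w;
  seed_prob_sum1 : \sum_w seed_prob w = 1;
  seed_alg : seed -> det_alg R T
}.

Definition expectation (R : realType) (T : finType) (a : rand_alg R T)
    (X : seed a -> R) : R :=
  \sum_w seed_prob w * X w.

(* The 1 keeps the factor positive when n <= 1 (ln 0 = 0 in the library). *)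
Definition polylog (R : realType) (k n : nat) : R := (1 + ln n%:R) ^+ k.

(* Main.v *)
Require Import Defs.
From HB Require Import structures.
From mathcomp Require Import all_boot all_order all_algebra.
From mathcomp Require Import reals sequences exp.
From mathcomp Require Import ring lra zify.

Set Implicit Arguments.
Unset Strict Implicit.
Unset Printing Implicit Defensive.

Import Order.TTheory GRing.Theory Num.Theory.

Local Open Scope ring_scope.

(** Elements are painted with [L] colors, and a non-oblivious local search swaps painted
    elements inside a base. The potential weights [f] of the elements whose color lies in [J]
    by a coefficient depending on [#|J|], chosen so that, summed over the colors in which [OPT]
    may be painted, the swap gains telescope to a multiple of
    [(1 - (1 + 1 / L) ^- L) * f OPT + ell OPT - f S - ell S]. Dummy elements turn additions
    and deletions into swaps.

    The search starts at a base [A0] of maximum weight and measures its potential relative to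
    [ell A0]. As [ell S <= ell A0] for every independent [S], this potential is at most a
    constant times [f S], so a small loss in the coefficient of [f] makes it grow
    geometrically as long as the current value is below the target. The best swap out of [A0]
    already reaches a fraction [1 / r] of the maximum potential, so [O(r log r)] rounds are
    enough for the (expected) best value met on the way to be at least the target.

    Submodularity bounds a swap gain from below by a difference of two marginals. Once the
    elements of the base are sorted by marginal, binary search finds the best partner of an
    element with logarithmically many independence queries. The deterministic algorithm
    tries all elements in each round; the randomized one tries [a] random elements against one
    random block of [b] elements of the base, with [a * b] about [n] and [b] at most about
    [sqrt n]. *)

(** * Exchange in matroids *)

Section Matroid.
Variables (T : finType) (M : matroid T).
Implicit Types (X Y Z U : {set T}) (x y : T).

Lemma indep_extend X Y : X \in indep M -> Y \in indep M -> (#|X| <= #|Y|)%N ->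
  exists Z, [/\ Z \in indep M, X \subset Z, Z \subset X :|: Y & #|Z| = #|Y|].
Proof.
move=> + Yi; move Ed : (#|Y| - #|X|)%N => d.
elim: d X Ed => [|d IH] X Ed Xi le_XY.
  exists X; rewrite subsetUl; split=> //.
  by apply/eqP; rewrite eqn_leq le_XY -subn_eq0 Ed.
have lt_XY : (#|X| < #|Y|)%N by rewrite -subn_gt0 Ed.
have [u /setDP[uY uX] uXi] := indep_augment Xi Yi lt_XY.
have [|//||Z [Zi sXZ sZ cZ]] := IH (u |: X); rewrite ?cardsU1 ?uX //.
  by rewrite subnS Ed.
exists Z; split => //; first by apply: subset_trans sXZ; apply: subsetUr.
by apply: subset_trans sZ _; rewrite -setUA subUset sub1set inE uY orbT /=.
Qed.

Definition is_base X := X \in indep M /\ forall Y, Y \in indep M -> (#|Y| <= #|X|)%N.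

Lemma base_card X Y : is_base X -> is_base Y -> #|X| = #|Y|.
Proof. by move=> [Xi mX] [Yi mY]; apply/eqP; rewrite eqn_leq mX ?mY. Qed.

Lemma swap_card X x y : x \in X -> y \notin X -> #|y |: X :\ x| = #|X|.
Proof.
move=> xX yX; rewrite cardsU1 !inE (negbTE yX) andbF /= (cardsD1 x X) xX.
by [].
Qed.

(* Extend [Z] inside [y |: X] to the size of [X]: exactly one element of [X] is missing. *)
Lemma indep_swap_out X y Z : X \in indep M -> y \notin X -> Z \in indep M ->
  y \in Z -> Z \subset y |: X -> (#|Z| <= #|X|)%N ->
  exists x, [/\ x \in X, x \notin Z & y |: X :\ x \in indep M].
Proof.
move=> Xi yX Zi yZ sZ le_ZX.
have [W [Wi sZW sW cW]] := indep_extend Zi Xi le_ZX.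
have yW : y \in W by apply: (subsetP sZW).
have sWX : W \subset y |: X.
  by apply: subset_trans sW _; rewrite subUset sZ subsetUr.
have [x xX xW] : exists2 x, x \in X & x \notin W.
  apply/subsetPn; apply/negP => sXW.
  have : (#|y |: X| <= #|W|)%N by apply: subset_leq_card; rewrite subUset sub1set yW.
  by rewrite cardsU1 yX cW ltnn.
exists x; split => //; first by apply: contra xW; apply: (subsetP sZW).
suff -> : y |: X :\ x = W by [].
apply/esym/eqP; rewrite eqEcard swap_card // cW leqnn andbT.
apply/subsetP => z zW; move/subsetP/(_ z zW): sWX; rewrite !inE.
by case: (z =P y) => //= _ zX; rewrite zX andbT; apply: contraNneq xW => <-.
Qed.

(** Here [D] is the fundamental circuit of [y] in [X], without [y], so [y |: D] is dependent. If no
    element of [D] could replace [y] in [Y], then [Y' = Y :\ y] would be a largest independent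
    subset of [D :|: Y']. Extend [D] inside this union to the size of [Y'] and augment from [Y]:
    this either adds [y] to [D] or exceeds that maximum. *)
Lemma base_symmetric_exchange X Y y : is_base X -> Y \in indep M -> y \in Y -> y \notin X ->
  exists x, [/\ x \in X, x \notin Y, y |: X :\ x \in indep M & x |: Y :\ y \in indep M].
Proof.
move=> [Xi Xmax] Yi yY yX.
pose D := [set x in X | y |: X :\ x \in indep M].
have sDX : D \subset X by apply/subsetP => x; rewrite inE => /andP[].
have Di : D \in indep M by apply: indep_sub Xi.
have yD : y \notin D by apply: contra yX; apply: (subsetP sDX).
have Dy : y |: D \notin indep M.
  apply/negP => yDi.
  have [x [xX xD Hx]] := indep_swap_out Xi yX yDi (setU11 _ _) (setUS _ sDX) (Xmax _ yDi).
  by move: xD; rewrite !inE xX Hx orbT.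
pose Y' := Y :\ y.
have Y'i : Y' \in indep M by apply: indep_sub Yi; apply: subsetDl.
have cY : #|Y| = #|Y'|.+1 by rewrite (cardsD1 y Y) yY.
suff : [exists x in D, (x \notin Y') && (x |: Y' \in indep M)].
  case/existsP => x; rewrite !inE => /and3P[/andP[xX Hx] xY' xYi].
  exists x; split=> //; apply: contra xY' => ->; rewrite andbT.
  by apply: contraNneq yX => <-.
apply: contraT => /existsPn H.
have {}H Z : Z \in indep M -> Z \subset D :|: Y' -> (#|Z| <= #|Y'|)%N.
  move=> Zi sZ; rewrite leqNgt; apply/negP => lt.
  have [u /setDP[uZ uY'] ui] := indep_augment Y'i Zi lt.
  move/subsetP/(_ u uZ): sZ; rewrite in_setU (negbTE uY') orbF => uD.
  by have := H u; rewrite uD uY' ui.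
have [W [Wi sDW sW cW]] := indep_extend Di Y'i (H _ Di (subsetUl _ _)).
have lt_WY : (#|W| < #|Y|)%N by rewrite cW cY.
have [u /setDP[uY uW] ui] := indep_augment Wi Yi lt_WY.
case: (u =P y) => [uy|/eqP uy].
  case/negP: Dy; apply: indep_sub ui; rewrite uy; exact: setUS.
have : (#|u |: W| <= #|Y'|)%N.
  by apply: H => //; rewrite subUset sW sub1set !inE uy uY orbT.
by rewrite cardsU1 uW cW ltnn.
Qed.

Lemma base_exchange_injection X Y : is_base X -> Y \in indep M ->
  exists p : T -> T, [/\ {in Y, forall y, p y \in X}, {in Y &, injective p},
    {in Y, forall y, y \in X -> p y = y} &
    {in Y, forall y, y \notin X -> y |: X :\ p y \in indep M}].
Proof.
move=> bX; move Ed : #|Y :\: X| => d; elim: d Y Ed => [|d IH] Y Ed Yi.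
  move/eqP: Ed; rewrite cards_eq0 setD_eq0 => /subsetP sYX.
  by exists id; split => // y /sYX -> //.
have [y] : exists y, y \in Y :\: X by apply/set0Pn; rewrite -cards_eq0 Ed.
case/setDP => yY yX.
have [x [xX xY Xyx Yxy]] := base_symmetric_exchange bX Yi yY yX.
have [|//|p [pX p_inj pid pI]] := IH (x |: Y :\ y).
  have -> : (x |: Y :\ y) :\: X = (Y :\: X) :\ y.
    apply/setP => z; rewrite !inE; case: (z =P x) => [->|_] /=; first by rewrite xX andbF.
    by case: (z == y); case: (z \in Y); case: (z \in X).
  by apply/eqP; rewrite -eqSS -Ed (cardsD1 y (Y :\: X)) !inE yY yX.
(* The new element [x] of [X] is fixed by [p], so injectivity keeps [p] away from [x] on the rest of
   [Y], and [x] is free to be the image of [y]. *)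
have px : p x = x by apply: pid; rewrite ?setU11.
have inY' z : z \in Y -> z != y -> z \in x |: Y :\ y by rewrite !inE => -> ->; rewrite orbT.
have pNx z : z \in Y -> z != y -> p z != x.
  move=> zY zy; apply: contraNneq xY => pz.
  by rewrite -(p_inj z x (inY' z zY zy) (setU11 _ _)) ?px.
exists (fun z => if z == y then x else p z); split.
- by move=> z zY; case: ifPn => // zy; apply/pX/inY'.
- move=> z1 z2 z1Y z2Y; do 2 case: ifPn => [/eqP->|?] //.
  + by move=> /esym/eqP; rewrite (negbTE (pNx _ _ _)).
  + by move=> /eqP; rewrite (negbTE (pNx _ _ _)).
  by apply: p_inj; apply: inY'.
- by move=> z zY zX; case: ifPn => [/eqP zy|zy]; [rewrite -zy zX in yX | apply/pid/zX/inY'].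
- by move=> z zY zX; case: ifPn => [/eqP->//|zy]; apply: pI => //; apply: inY'.
Qed.

(* The first prefix whose removal makes room for [y] ends with an element of the
   fundamental circuit of [y]. *)
Lemma swap_at_prefix X y (s : seq T) x : X \in indep M -> y \notin X -> x \in X ->
  y |: (X :\: [set z in s]) \notin indep M ->
  y |: (X :\: [set z in x :: s]) \in indep M ->
  y |: X :\ x \in indep M.
Proof.
move=> Xi yX xX nI Hi.
have sub : y |: (X :\: [set z in x :: s]) \subset y |: X by apply: setUS; apply: subsetDl.
have cle : (#|y |: (X :\: [set z in x :: s])| <= #|X|)%N.
  rewrite cardsU1 !inE (negbTE yX) andbF (cardsD1 x X) xX /= leq_add2l.
  by apply/subset_leq_card/subsetP=> z; rewrite !inE negb_or => /andP[/andP[-> _] ->].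
have [z [zX zn zI]] := indep_swap_out Xi yX Hi (setU11 _ _) sub cle.
case: (z =P x) => [<- //|/eqP zx].
case/negP: nI; apply: indep_sub zI; apply: setUS; apply/subsetP => u.
rewrite !inE => /andP[us ->]; rewrite andbT.
move: zn; rewrite !inE zX andbT !negb_or negb_and !negbK (negbTE zx) /= => /andP[_ zs].
by apply: contraNneq us => ->.
Qed.

Definition greedy_step (S : {set T}) x := if x |: S \in indep M then x |: S else S.
Definition greedy (l : seq T) := foldl greedy_step set0 l.

Lemma greedy_max (R : realType) (w : T -> R) (l : seq T) : (forall x, x \in l) ->
  sorted (fun x y => w y <= w x) l ->
  is_base (greedy l) /\ forall U, is_base U -> \sum_(u in U) w u <= \sum_(u in greedy l) w u.
Proof.
move=> all_l sorted_l.
have [B bB] : exists B, is_base B.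
  case: (@arg_maxnP _ set0 (mem (indep M)) (fun X => #|X|) (indep_set0 M)) => B Bi Bm.
  by exists B; split.
have trw : transitive (fun x y => w y <= w x) by move=> ? ? ? ? h; apply: le_trans h _.
(* The invariant compares greedy, resumed from [S], with a base [U] containing [S] whose other
   elements are all still to come. When greedy takes some [x] outside [U], the base is changed to
   [x |: U :\ y] with [y] still in the list, hence no heavier than [x]. *)
have step (S : {set T}) U : is_base U -> S \subset U ->
    {in U, forall z, z \notin l -> z \in S} ->
    is_base (foldl greedy_step S l) /\ \sum_(u in U) w u <= \sum_(u in foldl greedy_step S l) w u.
  elim: l sorted_l S U {all_l} => [|x l IH] sl S U bU sSU US /=.
    suff -> : S = U by [].
    by apply/eqP; rewrite eqEsubset sSU; apply/subsetP => z /US; apply.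
  have {}IH := IH (path_sorted sl).
  rewrite /greedy_step; case: ifPn => xSI; last first.
    apply: IH => // z zU zl; apply: US; rewrite // inE negb_or zl andbT.
    apply: contra xSI => /eqP <-; apply: indep_sub bU.1.
    by rewrite subUset sub1set zU.
  case: (boolP (x \in U)) => xU.
    apply: IH => //; first by rewrite subUset sub1set xU.
    move=> z zU zl; rewrite !inE; case: eqP => //= zx.
    by apply: US; rewrite // inE negb_or zl andbT; apply/eqP.
  have [y [yU yS xyI]] := indep_swap_out bU.1 xU xSI (setU11 _ _) (setUS _ sSU) (bU.2 _ xSI).
  move: yS; rewrite !inE negb_or => /andP[yx yS].
  have wyx : w y <= w x.
    have /allP := order_path_min trw sl; apply.
    have := contra (US y yU); rewrite yS inE (negbTE yx) /=.
    by rewrite negbK => ->.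
  have bU' : is_base (x |: U :\ y).
    by split=> // Z ZI; rewrite swap_card //; apply: bU.2.
  have [||bg le_g] := IH (x |: S) _ bU'.
  - by apply: setUS; rewrite subsetD1 sSU.
  - move=> z; rewrite !inE => /orP[->//|/andP[zy zU]] zl.
    case: (z =P x) => //= /eqP zx; apply: US => //.
    by rewrite inE negb_or zx.
  split=> //; apply: le_trans le_g.
  rewrite (big_setD1 y) //= big_setU1 /=; last by rewrite !inE (negbTE xU) andbF.
  by rewrite lerD2r.
have trivial U : {in U, forall z, z \notin l -> z \in (set0 : {set T})}.
  by move=> z _; rewrite all_l.
split; first by have [] := step set0 B bB (sub0set _) (trivial B).
by move=> U bU; have [] := step set0 U bU (sub0set _) (trivial U).
Qed.

End Matroid.

(** * The colored matroid with dummies *)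

Section ColoredMatroid.
Variables (T : finType) (M : matroid T) (L r : nat).

(* [(t, b, k)] is the element [t] painted with color [k]; [b = false] makes it a dummy,
   which is constrained only by the bound [r] on the size of independent sets. *)
Definition elt : Type := (T * bool * 'I_L)%type.
HB.instance Definition _ := Finite.on elt.
Implicit Types (A B : {set elt}) (x y : elt) (J : {set 'I_L}).

Definition genuine A := [set x in A | x.1.2].
Definition underlying A : {set T} := [set x.1.1 | x in genuine A].
Definition colored J A : {set T} := [set x.1.1 | x in [set x in A | x.1.2 && (x.2 \in J)]].

(** The equality of cardinals forbids the same element of [T] in two colors. *)
Definition colorful A := (#|A| <= r)%N && (#|underlying A| == #|genuine A|).
Definition ext_indep := [set A | colorful A && (underlying A \in indep M)].

Lemma genuineS A B : A \subset B -> genuine A \subset genuine B.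
Proof. by move=> s; apply/subsetP => x; rewrite !inE => /andP[/(subsetP s)-> ->]. Qed.

Lemma coloredT A : colored setT A = underlying A.
Proof.
suff e : [set x in A | x.1.2 && (x.2 \in setT)] = genuine A by rewrite /colored e.
by apply/setP => x; rewrite !inE andbT.
Qed.

Lemma coloredP J A t :
  reflect (exists2 k, k \in J & (t, true, k) \in A) (t \in colored J A).
Proof.
apply: (iffP imsetP) => [[[[t' b] k]]|[k kJ tA]].
  by rewrite inE /= => /and3P[tA /= + kJ] -> ; case: b tA => // tA _; exists k.
by exists (t, true, k); rewrite // inE tA.
Qed.

Lemma coloredS J A B : A \subset B -> colored J A \subset colored J B.
Proof.
by move=> s; apply/subsetP => t /coloredP[k kJ /(subsetP s) tB]; apply/coloredP; exists k.
Qed.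

Lemma coloredSl J J' A : J \subset J' -> colored J A \subset colored J' A.
Proof.
by move=> s; apply/subsetP => t /coloredP[k /(subsetP s) kJ tB]; apply/coloredP; exists k.
Qed.

Lemma coloredU J A B : colored J (A :|: B) = colored J A :|: colored J B.
Proof.
apply/setP => t; rewrite in_setU; apply/coloredP/orP => [[k kJ]|].
  by rewrite in_setU => /orP[] tA; [left|right]; apply/coloredP; exists k.
by case=> /coloredP[k kJ tA]; exists k => //; rewrite in_setU tA ?orbT.
Qed.

Lemma ext_indep0 : set0 \in ext_indep.
Proof.
have g0 : genuine set0 = set0 by apply/setP => x; rewrite !inE.
by rewrite inE /colorful /underlying g0 imset0 !cards0 eqxx indep_set0.
Qed.

Lemma ext_indep_sub A B : A \subset B -> B \in ext_indep -> A \in ext_indep.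
Proof.
move=> sAB; rewrite !inE => /andP[/andP[cB /imset_injP injB] iB].
have sg := genuineS sAB.
rewrite /colorful (leq_trans (subset_leq_card sAB) cB) (indep_sub (imsetS _ sg) iB) /= andbT.
by apply/imset_injP; apply: sub_in2 injB; apply/subsetP.
Qed.

(** A dummy of [B] outside [A] can always be added. If there is none, [A] has at least as many
    dummies as [B], hence fewer genuine elements, and augmentation in [M] applies to the underlying
    sets. *)
Lemma ext_indep_augment A B : A \in ext_indep -> B \in ext_indep -> (#|A| < #|B|)%N ->
  exists2 u, u \in B :\: A & u |: A \in ext_indep.
Proof.
rewrite !inE => /andP[/andP[cA injA] iA] /andP[/andP[cB injB] iB] ltAB.
have addP u : u \notin A -> u.1.2 = false -> u |: A \in ext_indep.
  move=> uA ub; have gu : genuine (u |: A) = genuine A.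
    by apply/setP => x; rewrite !inE; case: eqP => // ->; rewrite ub !andbF.
  by rewrite inE /colorful /underlying gu injA iA cardsU1 uA (leq_trans ltAB).
case: (boolP [exists u in B :\: A, ~~ u.1.2]) => [/existsP[u /andP[uBA /negbTE ub]]|].
  exists u => //. apply: addP => //; by case/setDP: uBA.
move=> /existsPn noD.
have cg (C : {set elt}) : #|C| = (#|genuine C| + #|[set x in C | ~~ x.1.2]|)%N.
  rewrite -(cardsID [set x : elt | x.1.2] C); congr (_ + _)%N.
    by apply: eq_card => x; rewrite !inE.
  by apply: eq_card => x; rewrite !inE andbC.
have ltg : (#|genuine A| < #|genuine B|)%N.
  have : (#|[set x in B | ~~ x.1.2]| <= #|[set x in A | ~~ x.1.2]|)%N.
    apply/subset_leq_card/subsetP => x; rewrite !inE => /andP[xB xb].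
    by have := noD x; rewrite !inE xB xb !andbT negbK => ->.
  move=> leD; rewrite ltnNge; apply/negP => leG.
  by move: ltAB; rewrite ltnNge (cg A) (cg B) leq_add.
have ltS : (#|underlying A| < #|underlying B|)%N by rewrite (eqP injA) (eqP injB).
have [t /setDP[tB tA] ti] := indep_augment iA iB ltS.
case/imsetP: tB => u ug tu; move: (ug); rewrite inE => /andP[uB ub].
have uA : u \notin A.
  by apply: contra tA => uA; apply/imsetP; exists u => //; rewrite inE uA.
exists u; first by rewrite inE uA.
have gu : genuine (u |: A) = u |: genuine A.
  by apply/setP => x; rewrite !inE; case: eqP => // ->.
have su : underlying (u |: A) = t |: underlying A by rewrite /underlying gu imsetU1 tu.
rewrite inE su ti andbT /colorful cardsU1 uA (leq_trans ltAB) //= su gu !cardsU1 tA.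
by rewrite inE (negbTE uA) /= eqn_add2l.
Qed.

Definition ext_matroid := Matroid ext_indep0 ext_indep_sub ext_indep_augment.

Lemma ext_underlyingP A : A \in ext_indep -> underlying A \in indep M.
Proof. by rewrite inE => /andP[]. Qed.

Lemma ext_card_le A : A \in ext_indep -> (#|A| <= r)%N.
Proof. by rewrite inE => /andP[/andP[]]. Qed.

Section Weights.
Variables (R : realType) (ell : {set T} -> R).
Definition weight x : R := if x.1.2 then ell [set x.1.1] else 0.

Lemma weight_sum A : setfun_linear ell -> A \in ext_indep ->
  \sum_(x in A) weight x = ell (underlying A).
Proof.
move=> lin; rewrite inE => /andP[/andP[_ /imset_injP inj] _].
rewrite lin big_imset //= [RHS](eq_bigl (fun x => (x \in A) && x.1.2)); last first.
  by move=> x; rewrite inE.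
rewrite [LHS](bigID (fun x => x.1.2)) /= [X in _ + X]big1 ?addr0; last first.
  by move=> x /andP[_ /negbTE xb]; rewrite /weight xb.
by apply: eq_bigr => x /andP[_ xb]; rewrite /weight xb.
Qed.

End Weights.

Definition paint k (S : {set T}) : {set elt} := [set (t, true, k) | t in S].

Lemma painted_base k S : S \in indep M -> (#|S| <= r)%N -> (r <= #|T|)%N ->
  exists O, [/\ O \in ext_indep, #|O| = r, paint k S \subset O & underlying O = S].
Proof.
move=> Si leS ler.
have injp : injective (fun t : T => (t, true, k) : elt) by move=> ? ? [].
have injd : injective (fun t : T => (t, false, k) : elt) by move=> ? ? [].
have gp : genuine (paint k S) = paint k S.
  apply/setP => x; rewrite inE; case: imsetP => //= -[t _ ->] //.
have sp : underlying (paint k S) = S.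
  by rewrite /underlying gp -imset_comp imset_id.
have pI : paint k S \in ext_indep.
  by rewrite inE /colorful sp gp Si card_imset // leS eqxx.
(* Augmenting from [r] dummies brings the painted set to size [r] without changing what underlies
   it; [r <= #|T|] provides enough dummies of one color. *)
pose D0 := [set ((t, false, k) : elt) | t in [set z in take r (enum T)]].
have cD0 : #|D0| = r.
  rewrite card_imset // cardsE (card_uniqP _) ?take_uniq ?enum_uniq //.
  by rewrite size_takel // -cardE.
have gD0 : genuine D0 = set0.
  by apply/setP => x; rewrite !inE; case: imsetP => //= -[t _ ->].
have D0I : D0 \in ext_indep.
  by rewrite inE /colorful /underlying gD0 imset0 !cards0 cD0 leqnn indep_set0.
have [O [OI sO sO' cO]] := @indep_extend _ ext_matroid _ _ pI D0I ltac:(by rewrite cD0 card_imset).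
exists O; split=> //; first by rewrite cO.
apply/eqP; rewrite eqEsubset -{2}sp imsetS ?genuineS // andbT.
rewrite -sp; apply: imsetS.
apply/subsetP => x; rewrite gp inE => /andP[/(subsetP sO')]; rewrite inE => /orP[//|xD xb].
have : x \in genuine D0 by rewrite inE xD.
by rewrite gD0 inE.
Qed.

Lemma ext_base_card A : (r <= #|T|)%N -> (0 < L)%N -> is_base ext_matroid A -> #|A| = r.
Proof.
move=> ler L0 [Ai Am].
have [O [OI cO _ _]] := painted_base (Ordinal L0) (indep_set0 M) ltac:(by rewrite cards0) ler.
by apply/eqP; rewrite eqn_leq ext_card_le // -{1}cO Am.
Qed.

Lemma ext_baseE A : A \in ext_indep -> #|A| = r -> is_base ext_matroid A.
Proof. by move=> Ai cA; split=> // Y /ext_card_le; rewrite cA. Qed.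

End ColoredMatroid.

(** * The non-oblivious potential *)

Section Submodular.
Variables (R : realType) (E : finType) (g : {set E} -> R).
Hypothesis g_sub : setfun_submodular g.
Implicit Types (A C O : {set E}) (u v : E).

Lemma submodular_sum_add A O : g (A :|: O) - g A <= \sum_(o in O) (g (o |: A) - g A).
Proof.
move Ed : #|O| => d; elim: d O Ed => [|d IH] O Ed.
  by move/eqP: Ed; rewrite cards_eq0 => /eqP ->; rewrite big_set0 setU0 subrr.
have [o oO] : exists o, o \in O by apply/set0Pn; rewrite -cards_eq0 Ed.
have cO : #|O :\ o| = d by apply/eqP; rewrite -eqSS -Ed (cardsD1 o O) oO.
rewrite (big_setD1 o) //=; have := IH _ cO.
have := g_sub (A :|: O :\ o) (o |: A).
have -> : (A :|: O :\ o) :|: (o |: A) = A :|: O.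
  by rewrite [o |: A]setUC setUACA setUid [_ :|: [set o]]setUC setD1K.
have -> : (A :|: O :\ o) :&: (o |: A) = A.
  apply/setP => z; rewrite !inE; case: (z =P o) => [->|] /=; first by rewrite andbT orbF.
  by case: (z \in A); rewrite ?andbF.
lra.
Qed.

Lemma submodular_sum_del A C : C \subset A ->
  \sum_(u in C) (g A - g (A :\ u)) <= g A - g (A :\: C).
Proof.
move Ed : #|C| => d; elim: d C Ed => [|d IH] C Ed sCA.
  by move/eqP: Ed; rewrite cards_eq0 => /eqP ->; rewrite big_set0 setD0 subrr.
have [c cC] : exists c, c \in C by apply/set0Pn; rewrite -cards_eq0 Ed.
have cC' : #|C :\ c| = d by apply/eqP; rewrite -eqSS -Ed (cardsD1 c C) cC.
rewrite (big_setD1 c) //=; have := IH _ cC' (subset_trans (subsetDl _ _) sCA).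
have cA : c \in A by apply: (subsetP sCA).
have := g_sub (A :\ c) (A :\: (C :\ c)).
have -> : (A :\ c) :&: (A :\: (C :\ c)) = A :\: C.
  apply/setP => z; rewrite !inE; case: (z =P c) => [->|_] /=; first by rewrite cC.
  by case: (z \in A); rewrite ?andbF ?andbT.
have -> : (A :\ c) :|: (A :\: (C :\ c)) = A.
  apply/setP => z; rewrite !inE; case: (z =P c) => [->|_] /=; first by rewrite cA.
  by case: (z \in A); rewrite ?andbF.
lra.
Qed.

Hypothesis g_mono : setfun_monotone g.

Lemma submodular_swap A u v : u \in A ->
  g (v |: A) - g A - (g A - g (A :\ u)) <= g (v |: A :\ u) - g A.
Proof.
(* For [v = u] the swap does nothing, and the left side is at most 0 by monotonicity. *)
move=> uA; case: (v =P u) => [->|/eqP vu].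
  by rewrite setD1K // (setUidPr _) ?sub1set //; have := g_mono (subD1set A u); lra.
have := g_sub A (v |: A :\ u).
have -> : A :&: (v |: A :\ u) = A :\ u.
  apply/setP => z; rewrite !inE; case: (z =P v) => [->|_] /=; first by rewrite vu andbT.
  by case: (z \in A); rewrite ?andbF.
have -> : A :|: (v |: A :\ u) = v |: A.
  by apply/setP => z; rewrite !inE; case: (z \in A); rewrite ?andbF ?orbF ?orbT.
lra.
Qed.

End Submodular.

Section Potential.
Variables (R : realType) (T : finType) (L : nat) (f : {set T} -> R) (a : nat -> R).
Local Notation elt := (elt T L).
Implicit Types (A O : {set elt}) (J : {set 'I_L}).

Definition potential A : R := \sum_(J : {set 'I_L}) a #|J| * f (colored J A).

Hypotheses (f_ge0 : setfun_nonneg f) (f_mono : setfun_monotone f)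
  (f_sub : setfun_submodular f) (a_ge0 : forall i, 0 <= a i).

Lemma potential_ge0 A : 0 <= potential A.
Proof. by apply: sumr_ge0 => J _; apply: mulr_ge0. Qed.

Lemma potential_mono : setfun_monotone potential.
Proof.
move=> A B sAB; apply: ler_sum => J _; apply: ler_wpM2l => //.
by apply/f_mono/coloredS.
Qed.

Lemma colored_sub J : setfun_submodular (fun A => f (colored J A)).
Proof.
move=> A B; rewrite coloredU; apply: le_trans (f_sub _ _); rewrite lerD2r.
by apply: f_mono; rewrite subsetI !coloredS ?subsetIl ?subsetIr.
Qed.

Lemma potential_sub : setfun_submodular potential.
Proof.
move=> A B; rewrite -!big_split /=; apply: ler_sum => J _.
by rewrite -!mulrDr ler_wpM2l //; apply: colored_sub.
Qed.

Lemma potential_le A : potential A <= (\sum_(J : {set 'I_L}) a #|J|) * f (underlying A).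
Proof.
rewrite mulr_suml; apply: ler_sum => J _; apply: ler_wpM2l => //.
by apply: f_mono; rewrite -coloredT coloredSl ?subsetT.
Qed.

(** The union [O :|: A] contains all of [S] in color [k], so [colored J] of it contains [S] as soon
    as [k \in J]. The other [J] contribute nonnegative terms, which are dropped. *)
Lemma potential_add_paint A O k (S : {set T}) : paint k S \subset O ->
  \sum_(J : {set 'I_L} | k \in J) a #|J| * (f S - f (colored J A)) <=
  \sum_(o in O) (potential (o |: A) - potential A).
Proof.
move=> sO; apply: le_trans (submodular_sum_add potential_sub _ _).
rewrite -sumrB big_mkcond; apply: ler_sum => J _; rewrite -mulrBr.
case: ifP => kJ; last first.
  by apply: mulr_ge0 => //; rewrite subr_ge0; apply/f_mono/coloredS/subsetUl.
apply: ler_wpM2l => //; rewrite lerD2r; apply: f_mono; apply/subsetP => t tS.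
apply/coloredP; exists k => //; rewrite inE (subsetP sO) ?orbT //.
by apply/imsetP; exists t.
Qed.

(** For a fixed [J], only genuine elements with a color in [J] matter. Within one color [j],
    submodularity bounds the sum of the single losses by the loss of the whole color class, and what
    remains still contains [colored (J :\ j) A]. *)
Lemma potential_del A :
  \sum_(u in A) (potential A - potential (A :\ u)) <=
  \sum_(J : {set 'I_L}) a #|J| * \sum_(j in J) (f (colored J A) - f (colored (J :\ j) A)).
Proof.
under eq_bigr => u _ do rewrite -sumrB.
rewrite exchange_big /=; apply: ler_sum => J _.
under eq_bigr => u _ do rewrite -mulrBr.
rewrite -mulr_sumr; apply: ler_wpM2l => //.
rewrite (bigID (fun u : elt => u.1.2 && (u.2 \in J))) /= [X in _ + X]big1 ?addr0; last first.
  move=> u /andP[uA uJ]; apply/eqP; rewrite subr_eq0; apply/eqP; congr f.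
  apply/setP => t; apply/coloredP/coloredP => -[k kJ tA]; exists k => //; last first.
    by move: tA; rewrite inE => /andP[].
  by rewrite !inE tA andbT; apply: contra uJ => /eqP <-.
rewrite (partition_big (fun u : elt => u.2) (mem J)) /=; last by move=> u /and3P[].
apply: ler_sum => j jJ.
pose C := [set u in A | u.1.2 && (u.2 == j)].
rewrite (eq_bigl (mem C)); last first.
  move=> u; rewrite !inE -!andbA; case: (u.2 =P j) => [->|_]; rewrite ?andbF //.
  by rewrite jJ.
have sCA : C \subset A by apply/subsetP => u; rewrite inE => /andP[].
apply: le_trans (submodular_sum_del (colored_sub J) sCA) _.
rewrite lerD2l lerN2; apply: f_mono; apply/subsetP => t /coloredP[k].
rewrite !inE => /andP[kj kJ] tA; apply/coloredP; exists k => //.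
by rewrite !inE tA (negbTE kj).
Qed.

(** Each [J] arises as [J' :\ j] once for every color [j] outside [J], that is [L - #|J|] times. *)
Lemma sum_remove_color A :
  \sum_(J : {set 'I_L}) a #|J| * \sum_(j in J) f (colored (J :\ j) A) =
  \sum_(J : {set 'I_L}) (L - #|J|)%:R * a #|J|.+1 * f (colored J A).
Proof.
pose h J := a #|J|.+1 * f (colored J A).
transitivity (\sum_j \sum_(J : {set 'I_L} | j \in J) h (J :\ j)).
  rewrite (exchange_big_dep xpredT) //=; apply: eq_bigr => J _; rewrite mulr_sumr.
  by apply: eq_bigr => j jJ; rewrite /h (cardsD1 j J) jJ.
transitivity (\sum_j \sum_(J : {set 'I_L} | j \notin J) h J).
  apply: eq_bigr => j _.
  rewrite (reindex_onto (fun J => j |: J) (fun J => J :\ j)) /=; last first.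
    by move=> J; apply: setD1K.
  apply: eq_big => [J|J].
    rewrite setU11 /=; apply/eqP/idP => [<-|]; first by rewrite !inE eqxx.
    exact: setU1K.
  by case/andP=> _ /eqP ->.
rewrite (exchange_big_dep xpredT) //=; apply: eq_bigr => J _.
rewrite sumr_const -[LHS]mulr_natl -[RHS]mulrA; congr (_%:R * _).
by have := cardsCs (~: J); rewrite setCK card_ord => <-; apply: eq_card => j; rewrite !inE.
Qed.

Variables (b c : R).
Hypotheses (L_gt0 : (0 < L)%N)
  (a_rec : forall i, (0 < i < L)%N -> L.+1%:R * i%:R * a i = L%:R * (L - i)%:R * a i.+1)
  (a_top : L.+1%:R * a L = c)
  (a_sum : \sum_(J : {set 'I_L}) #|J|%:R * a #|J| = L%:R * b).

(* The recurrence on [a] cancels every term except [J = setT] (and the empty one, which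
   has the right sign) after summing the gains over all colors [k]. *)
Lemma potential_local A (S : {set T}) : exists k : 'I_L, forall O, paint k S \subset O ->
  b * f S - c * f (underlying A) <=
  \sum_(o in O) (potential (o |: A) - potential A) -
  \sum_(u in A) (potential A - potential (A :\ u)).
Proof.
pose D := \sum_(J : {set 'I_L}) a #|J| * \sum_(j in J) (f (colored J A) - f (colored (J :\ j) A)).
pose B k := \sum_(J : {set 'I_L} | k \in J) a #|J| * (f S - f (colored J A)).
suff [k Hk] : exists k, b * f S - c * f (underlying A) <= B k - D.
  exists k => O sO; apply: le_trans Hk _; apply: lerB; last exact: potential_del.
  exact: potential_add_paint.
have LR : 0 < L%:R :> R by rewrite ltr0n.
(* It is enough to bound the sum over all colors: some color does at least as well as the
   average. *)
suff H : L%:R * (b * f S - c * f (underlying A)) <= \sum_k B k - L%:R * D.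
  apply/existsP; apply: contraT => /existsPn lt.
  have : \sum_(k < L) (B k - D) < \sum_(k < L) (b * f S - c * f (underlying A)).
    apply: ltr_sum; last by move=> k _; rewrite ltNge lt.
    by apply/hasP; exists (Ordinal L_gt0); rewrite // mem_index_enum.
  rewrite sumrB !sumr_const card_ord -[D *+ _]mulr_natl -[X in _ < X -> _]mulr_natl.
  by rewrite ltNge H.
have -> : \sum_k B k = \sum_(J : {set 'I_L}) #|J|%:R * a #|J| * (f S - f (colored J A)).
  rewrite /B (exchange_big_dep xpredT) //=; apply: eq_bigr => J _.
  by rewrite sumr_const -[LHS]mulr_natl mulrA.
have -> : D = \sum_(J : {set 'I_L}) (#|J|%:R * a #|J| * f (colored J A)
                - (L - #|J|)%:R * a #|J|.+1 * f (colored J A)).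
  rewrite sumrB -sum_remove_color -sumrB; apply: eq_bigr => J _.
  rewrite sumrB sumr_const -[f _ *+ _]mulr_natl; ring.
under eq_bigr => J _ do rewrite mulrBr.
rewrite sumrB -mulr_suml a_sum.
rewrite mulr_sumr -addrA -opprD -big_split /= mulrBr !mulrA lerD2l lerN2.
rewrite (bigD1 [set: 'I_L]) //= cardsT card_ord subnn coloredT -[X in _ <= X]addr0.
apply: lerD; first by rewrite -a_top !mul0r subr0 mulrA -[L.+1]addn1 natrD; lra.
apply: sumr_le0 => J JT; rewrite [X in X <= 0](_ : _ =
  (L.+1%:R * #|J|%:R * a #|J| - L%:R * (L - #|J|)%:R * a #|J|.+1) * f (colored J A)).
  case: (posnP #|J|) => [J0|Jpos].
    rewrite J0 mulr0 mul0r sub0r mulNr oppr_le0 !mulr_ge0 //.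
  rewrite a_rec ?subrr ?mul0r // Jpos /= ltnNge; apply: contra JT => cJ.
  by rewrite eqEcard subsetT cardsT card_ord.
rewrite -[L.+1]addn1 natrD; ring.
Qed.

End Potential.

(** * Coefficients of the potential *)

Section Coefficients.
Variable R : realType.

(* Normalized so that [ell] enters the potential with coefficient 1. *)
Definition coef (d : R) (L i : nat) : R :=
  (L%:R / L.+1%:R) ^+ (L - i) / ((1 + d) * L.+1%:R * 'C(L.-1, i.-1)%:R).

Variables (d : R) (L : nat).
Hypotheses (d_ge0 : 0 <= d) (L_gt0 : (0 < L)%N).

Lemma coef_ge0 i : 0 <= coef d L i.
Proof. by rewrite divr_ge0 ?mulr_ge0 ?exprn_ge0 ?divr_ge0 // addr_ge0. Qed.

Lemma coef_top : L.+1%:R * coef d L L = (1 + d)^-1.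
Proof.
rewrite /coef subnn binn expr0; field.
by rewrite nat1r pnatr_eq0 lt0r_neq0 // ltr_pwDl.
Qed.

Lemma coef_rec i : (0 < i < L)%N ->
  L.+1%:R * i%:R * coef d L i = L%:R * (L - i)%:R * coef d L i.+1.
Proof.
case: i => [//|i]; case: L L_gt0 => [//|l _] /andP[_]; rewrite ltnS => lt_il.
rewrite /coef /= !subSS -[(l - i)%N]prednK ?subn_gt0 // -subnS exprS.
have C1 : 'C(l, i)%:R != 0 :> R by rewrite pnatr_eq0 -lt0n bin_gt0 ltnW.
have C2 : 'C(l, i.+1)%:R != 0 :> R by rewrite pnatr_eq0 -lt0n bin_gt0.
have E : i.+1%:R * 'C(l, i.+1)%:R = (l - i.+1).+1%:R * 'C(l, i)%:R :> R.
  by rewrite -!natrM mul_bin_left subnSK.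
have D1 : 1 + d != 0 by rewrite lt0r_neq0 // ltr_pwDl.
have D2 : l.+2%:R != 0 :> R by rewrite pnatr_eq0.
have -> : i.+1%:R = (l - i.+1).+1%:R * 'C(l, i)%:R / 'C(l, i.+1)%:R :> R.
  by rewrite -E mulfK.
set q := (_ / _) ^+ _; move: q => q.
move: l.+2%:R D2 l.+1%:R => K D2 K1.
by field; rewrite C1 C2 D1 D2.
Qed.

Lemma sum_by_card (n : nat) (F : nat -> R) :
  \sum_(J : {set 'I_n}) F #|J| = \sum_(i < n.+1) 'C(n, i)%:R * F i.
Proof.
have le_card (J : {set 'I_n}) : (#|J| < n.+1)%N.
  by rewrite ltnS; have := max_card (mem J); rewrite card_ord.
rewrite (partition_big (fun J => Ordinal (le_card J)) xpredT) //=.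
apply: eq_bigr => i _; rewrite (eq_bigr (fun _ => F i)); last by move=> J /eqP <-.
rewrite sumr_const -[LHS]mulr_natl; congr (_%:R * _).
by have := card_draws 'I_n i; rewrite card_ord => <-; apply: eq_card => J; rewrite inE.
Qed.

Definition coef_ratio : R := (1 - (L%:R / L.+1%:R) ^+ L) / (1 + d).

(** The identity [i * 'C(L, i) = L * 'C(L.-1, i.-1)] cancels the binomial in the denominator of
    [coef], leaving a geometric sum of ratio [q = L / (L + 1)], where [1 - q = 1 / (L + 1)]. *)
Lemma coef_weighted_sum : \sum_(J : {set 'I_L}) #|J|%:R * coef d L #|J| = L%:R * coef_ratio.
Proof.
rewrite (sum_by_card L (fun i => i%:R * coef d L i)) big_ord_recl mul0r mulr0 add0r.
have D1 : 1 + d != 0 by rewrite lt0r_neq0 // ltr_pwDl.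
have D2 : L.+1%:R != 0 :> R by rewrite pnatr_eq0.
pose q : R := L%:R / L.+1%:R.
transitivity (L%:R / ((1 + d) * L.+1%:R) * \sum_(i < L) q ^+ i); last first.
  have -> : \sum_(i < L) q ^+ i = (1 - q ^+ L) * L.+1%:R.
    rewrite -[1 - _]opprB subrX1 /q -[L.+1]addn1 natrD.
    by field; rewrite -natr1 in D2.
  by rewrite /coef_ratio -/q; move: q L.+1%:R D2 => q K D2; field; rewrite D1 D2.
rewrite mulr_sumr (reindex_inj rev_ord_inj) /=; apply: eq_bigr => i _.
rewrite /coef -/q /bump /= add1n add0n.
have C1 : 'C(L.-1, L - i.+1)%:R != 0 :> R.
  by rewrite pnatr_eq0 -lt0n bin_gt0 subnS -!subn1 leq_sub2r // leq_subr.
have E : 'C(L, (L - i.+1).+1)%:R * (L - i.+1).+1%:R = L%:R * 'C(L.-1, L - i.+1)%:R :> R.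
  by rewrite -!natrM mul_bin_diag mulnC.
rewrite mulrA E subnSK // subKn 1?ltnW //.
by move: (q ^+ i) L.+1%:R D2 => qi K D2; field; rewrite C1 D1 D2.
Qed.

End Coefficients.

(** With [1 + x <= expR x], the power [(L / (L + 1)) ^ L] is at most
    [expR (-1) * expR (1 / (L + 1))], hence at most [expR (-1) * (1 + 1 / L)], which costs
    [eps / 2]. Dividing by [1 + eps / 2] costs the other half. *)
Lemma coef_ratio_ge (R : realType) (eps : R) (L : nat) : 0 < eps -> 2 / eps <= L%:R ->
  1 - 1 / expR 1 - eps <= coef_ratio (eps / 2) L.
Proof.
move=> e0 le_L; have L0 : 0 < L%:R :> R by apply: lt_le_trans le_L; rewrite divr_gt0.
have qe : (L%:R / L.+1%:R) ^+ L <= 1 / expR 1 + eps / 2 :> R.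
  have d1 : L.+1%:R != 0 :> R by rewrite pnatr_eq0.
  have -> : L%:R / L.+1%:R = 1 + - (L.+1%:R^-1) :> R.
    by rewrite -natr1 in d1 *; field.
  apply: (@le_trans _ _ (expR (- L.+1%:R^-1) ^+ L)).
    apply: lerXn2r; rewrite ?nnegrE ?expR_ge0 ?expR_ge1Dx //.
    by rewrite subr_ge0 invf_le1 ?ltr0n // ler1n.
  rewrite -expRM_natl.
  have -> : L%:R * - L.+1%:R^-1 = - 1 + L.+1%:R^-1 :> R.
    by rewrite -natr1 in d1 *; field.
  rewrite expRD expRN mul1r -[X in _ <= X + _]mulr1 -lerBlDl -mulrBr.
  have e1 : (expR 1)^-1 <= 1 :> R.
    by rewrite invf_le1 ?expR_gt0 // -[X in X <= _](@expR0 R) ler_expR.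
  have e2 : expR (L.+1%:R^-1) <= 1 + L%:R^-1 :> R.
    have := @expR_ge1Dx R (- L.+1%:R^-1); rewrite expRN => h.
    have -> : 1 + L%:R^-1 = (1 + - L.+1%:R^-1)^-1 :> R.
      rewrite -natr1 in d1 *; field; rewrite d1 /=.
      by rewrite addrK lt0r_neq0.
    rewrite -[X in X <= _]invrK lef_pV2 ?posrE ?invr_gt0 ?expR_gt0 //.
    by rewrite subr_gt0 invf_lt1 ?ltr0n // ltr1n ltnS -(ltr0n R).
  have e3 : L%:R^-1 <= eps / 2.
    by rewrite -[X in _ <= X]invrK lef_pV2 ?posrE ?invr_gt0 ?divr_gt0 // invf_div.
  have p : 0 <= (expR 1)^-1 :> R by rewrite invr_ge0 expR_ge0.
  have : expR (L.+1%:R^-1) - 1 <= eps / 2 by lra.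
  move=> h; apply: le_trans (ler_wpM2l p h) _.
  by rewrite ler_piMl // divr_ge0 // ltW.
have q0 : 0 <= (L%:R / L.+1%:R) ^+ L :> R by rewrite exprn_ge0 ?divr_ge0.
rewrite /coef_ratio ler_pdivlMr; last by rewrite ltr_pwDl // divr_ge0 ?ltW.
have p : 0 <= 1 / expR 1 :> R by rewrite divr_ge0 ?expR_ge0.
move: (1 / expR 1) qe p => E; move: (_ ^+ L) q0 => Q; nra.
Qed.

(** * Query procedures *)

Section Queries.
Variables (R : realType) (T : finType).
Implicit Types (f : {set T} -> R) (M : matroid T).

(** The continuation receives the answers as a function equal to 0 outside the list, so it depends
    on [f] only through the values that were queried. *)
Fixpoint ask_values (l : seq {set T}) (k : ({set T} -> R) -> det_alg R T) : det_alg R T :=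
  if l is X :: l' then
    QueryValue X (fun x => ask_values l' (fun F => k (fun U => if U == X then x else F U)))
  else k (fun=> 0).

Fixpoint table f (l : seq {set T}) : {set T} -> R :=
  if l is X :: l' then fun U => if U == X then f X else table f l' U else fun=> 0.

Lemma output_ask_values f M l k : output f M (ask_values l k) = output f M (k (table f l)).
Proof. by elim: l k => //= S l IH k; rewrite IH. Qed.

Lemma queries_ask_values f M l k :
  queries f M (ask_values l k) = (size l + queries f M (k (table f l)))%N.
Proof. by elim: l k => //= S l IH k; rewrite IH. Qed.

Lemma tableE f l S : S \in l -> table f l S = f S.
Proof. by elim: l => //= S' l IH; rewrite inE; case: eqP => [->|] //=. Qed.

End Queries.

(** * Binary search for the best swap *)

Section BinarySearch.

Fixpoint search (p : pred nat) n lo :=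
  if n is n'.+1 then
    if p (lo + (2 ^ n').-1)%N then search p n' lo else search p n' (lo + 2 ^ n')%N
  else lo.

(** The first index where [p] holds stays among the [2 ^ n] integers starting at [lo]. *)
Lemma search_first (p : pred nat) n lo : (forall i j, (i <= j)%N -> p i -> p j) ->
  (forall j, (j < lo)%N -> ~~ p j) -> p (lo + (2 ^ n).-1)%N ->
  p (search p n lo) /\ forall j, (j < search p n lo)%N -> ~~ p j.
Proof.
move=> mono; elim: n lo => [|n IH] lo Hlo Hp /=; first by rewrite addn0 in Hp.
have n0 : (0 < 2 ^ n)%N by rewrite expn_gt0.
case: ifPn => pm; apply: IH => //.
  move=> j lt; apply: contra pm => pj; apply: mono pj; lia.
by move: Hp; rewrite expnS; congr (p _); lia.
Qed.

End BinarySearch.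

Section SwapSearch.
Variables (R : realType) (T : finType) (f : {set T} -> R) (M : matroid T).
Variables (E : finType) (N : matroid E).
Variable ask : {set E} -> (bool -> det_alg R T) -> det_alg R T.
Hypothesis output_ask : forall A k, output f M (ask A k) = output f M (k (A \in indep N)).
Hypothesis queries_ask : forall A k,
  queries f M (ask A k) = (queries f M (k (A \in indep N))).+1.

Fixpoint ask_greedy (l : seq E) (S : {set E}) (k : {set E} -> det_alg R T) :=
  if l is x :: l' then
    ask (x |: S) (fun b => ask_greedy l' (if b then x |: S else S) k)
  else k S.

Lemma output_ask_greedy l S k :
  output f M (ask_greedy l S k) = output f M (k (foldl (greedy_step N) S l)).
Proof. by elim: l S => //= x l IH S; rewrite output_ask IH. Qed.

Lemma queries_ask_greedy l S k : queries f M (ask_greedy l S k) =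
  (size l + queries f M (k (foldl (greedy_step N) S l)))%N.
Proof. by elim: l S => //= x l IH S; rewrite queries_ask IH. Qed.

Fixpoint ask_search (q : nat -> {set E}) n lo (k : nat -> det_alg R T) :=
  if n is n'.+1 then
    ask (q (lo + (2 ^ n').-1)%N) (fun b =>
      if b then ask_search q n' lo k else ask_search q n' (lo + 2 ^ n')%N k)
  else k lo.

Lemma output_ask_search q n lo k : output f M (ask_search q n lo k) =
  output f M (k (search (fun i => q i \in indep N) n lo)).
Proof. by elim: n lo => //= n IH lo; rewrite output_ask; case: ifP; rewrite IH. Qed.

Lemma queries_ask_search q n lo k : queries f M (ask_search q n lo k) =
  (n + queries f M (k (search (fun i => q i \in indep N) n lo)))%N.
Proof. by elim: n lo => //= n IH lo; rewrite queries_ask; case: ifP; rewrite IH. Qed.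

Variables (A : {set E}) (wv wu : E -> R).
Implicit Types (s V : seq E) (u v : E).

Definition insert_without s v i := v |: (A :\: [set z in take i s]).
(** Prefix lengths range from 0 to [size s] inclusive, which is at most [2 ^ search_depth s]
    candidates. *)
Definition search_depth s := (trunc_log 2 (size s)).+1.

(** An element already in the base can only be swapped with itself. Otherwise one query tests
    whether removing all of [s] makes room for [v]; if so, the search finds the shortest sufficient
    prefix, whose last element has index [i.-1]. *)
Definition ask_partner s v (k : option E -> det_alg R T) :=
  if v \in A then k (if v \in s then Some v else None)
  else ask (insert_without s v (size s)) (fun b =>
    if b then ask_search (insert_without s v) (search_depth s) 0
      (fun i => k (Some (nth v s i.-1)))
    else k None).

Definition partner s v :=
  if v \in A then if v \in s then Some v else None
  else if insert_without s v (size s) \in indep N then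
    Some (nth v s (search (fun i => insert_without s v i \in indep N) (search_depth s) 0).-1)
  else None.

Lemma output_ask_partner s v k :
  output f M (ask_partner s v k) = output f M (k (partner s v)).
Proof.
rewrite /ask_partner /partner; case: ifP => // _.
by rewrite output_ask; case: ifP => // _; rewrite output_ask_search.
Qed.

Lemma queries_ask_partner s v k : (queries f M (ask_partner s v k) <=
  (search_depth s).+1 + queries f M (k (partner s v)))%N.
Proof.
rewrite /ask_partner /partner; case: ifP => _; first by rewrite leq_addl.
rewrite queries_ask; case: ifP => _; first by rewrite queries_ask_search addSn.
by rewrite addSn ltnS leq_addl.
Qed.

Hypothesis A_base : is_base N A.

(** If [v] can replace [u], then removing the prefix that ends at [u] makes room for [v]. The
    shortest sufficient prefix therefore ends no later than [u] in the order of increasing [wu]. *)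
Lemma partner_best s v u : sorted (fun x y => wu x <= wu y) s -> {subset s <= A} ->
  u \in s -> is_base N (v |: A :\ u) ->
  exists2 u', partner s v = Some u' & wu u' <= wu u.
Proof.
move=> sorted_s sA us bA'.
rewrite /partner; case: ifPn => vA.
  case: (v =P u) => [->|/eqP vu]; first by rewrite us; exists u.
  have /(base_card A_base) := bA'.
  rewrite (setUidPr _) ?sub1set ?inE ?vu // (cardsD1 u A) sA // => /eqP.
  by rewrite add1n eqn_leq ltnn.
set q := insert_without s v; pose p i := q i \in indep N.
have mono i j : (i <= j)%N -> p i -> p j.
  move=> le_ij; apply: indep_sub; apply/setUS/setDS/subsetP => z; rewrite !inE.
  by rewrite -(subnKC le_ij) takeD mem_cat => ->.
have pu : p (index u s).+1.
  apply: indep_sub bA'.1; apply/setUS/subsetP => z; rewrite !inE => /andP[zs ->].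
  rewrite andbT; apply: contra zs => /eqP ->.
  by rewrite (take_nth u) ?index_mem // mem_rcons inE nth_index ?eqxx.
have ps : p (size s) by apply: mono pu; rewrite index_mem.
rewrite [_ \in _]ps.
have [||pi] := @search_first p (search_depth s) 0 mono; first by [].
  have : (size s < 2 ^ search_depth s)%N by apply: trunc_log_ltn.
  by move=> lt; apply: mono ps; lia.
rewrite -/p; set i := search _ _ _ in pi * => first_i.
have i_le : (i <= (index u s).+1)%N.
  by rewrite leqNgt; apply/negP => /first_i; rewrite pu.
exists (nth v s i.-1) => //.
rewrite -[u in X in _ <= X](nth_index v us).
have tr : transitive (fun x y => wu x <= wu y) by move=> ? ? ?; apply: le_trans.
have lt_u : (index u s < size s)%N by rewrite index_mem.
by apply: (sorted_leq_nth tr (fun x => lexx _) v sorted_s); rewrite ?inE; lia.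
Qed.

Lemma partner_swap s v u : {subset s <= A} -> partner s v = Some u ->
  u \in s /\ is_base N (v |: A :\ u).
Proof.
move=> sA; rewrite /partner; case: ifPn => vA.
  by case: ifP => // vs [<-]; rewrite setD1K.
set q := insert_without s v; pose p i := q i \in indep N.
have [Ai Amax] := A_base.
case: ifPn => // ps [].
have mono i j : (i <= j)%N -> p i -> p j.
  move=> le_ij; apply: indep_sub; apply/setUS/setDS/subsetP => z; rewrite !inE.
  by rewrite -(subnKC le_ij) takeD mem_cat => ->.
have [||pi] := @search_first p (search_depth s) 0 mono; first by [].
  have : (size s < 2 ^ search_depth s)%N by apply: trunc_log_ltn.
  by move=> lt; apply: mono ps; lia.
rewrite -/p; set i := search _ _ _ in pi * => first_i uE.
(* A base has no room for [v], so the first good prefix is nonempty and its predecessor is bad. *)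
have np0 : ~~ p 0.
  rewrite /p /q /insert_without take0; apply/negP => vI.
  have := Amax _ vI; rewrite cardsU1 !inE (negbTE vA) andbF.
  have -> : A :\: [set z in [::]] = A by apply/setP => z; rewrite !inE.
  by rewrite ltnn.
have i0 : (0 < i)%N by case: (i) pi np0 => // ->.
have npi : ~~ p i.-1 by apply: first_i; rewrite prednK.
(* Thus [nth] does not fall back on its default [v]. *)
have ilt : (i.-1 < size s)%N.
  by rewrite ltnNge; apply: contra npi => le; apply: mono le ps.
have us : u \in s by rewrite -uE mem_nth.
have uA : u \in A by apply: sA.
split=> //; split; last by move=> Y YI; rewrite swap_card //; apply: Amax.
apply: (swap_at_prefix Ai vA uA npi).
suff <- : [set z in take i s] = [set z in u :: take i.-1 s] by [].
apply/setP => z; rewrite -{1}(prednK i0) (take_nth v) // uE.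
by rewrite !inE mem_rcons inE.
Qed.

Definition better v (cur : R * {set E}) (o : option E) :=
  if o is Some u then
    if cur.1 < wv v - wu u then (wv v - wu u, v |: A :\ u) else cur
  else cur.

Fixpoint ask_best_from V s cur (k : {set E} -> det_alg R T) :=
  if V is v :: V' then ask_partner s v (fun o => ask_best_from V' s (better v cur o) k)
  else k cur.2.

Fixpoint best_from V s cur :=
  if V is v :: V' then best_from V' s (better v cur (partner s v)) else cur.

Lemma output_ask_best_from V s cur k :
  output f M (ask_best_from V s cur k) = output f M (k (best_from V s cur).2).
Proof. by elim: V cur => //= v V IH cur; rewrite output_ask_partner IH. Qed.

Lemma queries_ask_best_from V s cur k : (queries f M (ask_best_from V s cur k) <=
  size V * (search_depth s).+1 + queries f M (k (best_from V s cur).2))%N.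
Proof.
elim: V cur => //= v V IH cur; apply: leq_trans (queries_ask_partner _ _ _) _.
by rewrite mulSn -addnA leq_add2l.
Qed.

Variable G : {set E} -> R.
(** Swaps are compared by the score [wv v - wu u], and [G] is any quantity that the scores bound
    from below, such as the change of the potential. The [G] of the chosen swap is thus at least
    every score. *)
Lemma best_from_spec V s cur : sorted (fun x y => wu x <= wu y) s -> {subset s <= A} ->
  (forall u v, u \in s -> v \in V -> is_base N (v |: A :\ u) ->
    wv v - wu u <= G (v |: A :\ u)) ->
  is_base N cur.2 -> cur.1 <= G cur.2 ->
  let res := best_from V s cur in
  [/\ is_base N res.2, res.1 <= G res.2, cur.1 <= res.1 &
    forall u v, u \in s -> v \in V -> is_base N (v |: A :\ u) -> wv v - wu u <= res.1].
Proof.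
move=> sorted_s sA; elim: V cur => [|v V IH] cur G_swap bc Gc //=.
set cur' := better _ _ _.
have [bc' Gc' le_c] : [/\ is_base N cur'.2, cur'.1 <= G cur'.2 & cur.1 <= cur'.1].
  rewrite /cur' /better; case Eu : (partner s v) => [u|//]; case: ifPn => // lt.
  have [us bA'] := partner_swap sA Eu.
  by split=> //=; [apply: G_swap; rewrite ?inE ?eqxx | apply: ltW].
have G_swap' u v' (us : u \in s) (v'V : v' \in V) := G_swap u v' us (@mem_behead _ (v :: V) v' v'V).
have [b1 b2 b3 b4] := IH cur' G_swap' bc' Gc'; split=> //; first exact: le_trans b3.
move=> u v' us; rewrite inE => /orP[/eqP->|]; last exact: b4.
move=> bA'; apply: le_trans b3.
have [u' Eu le_u] := partner_best sorted_s sA us bA'.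
rewrite /cur' /better Eu; case: (ltP cur.1) => h /=; first by rewrite lerD2l lerN2.
by apply: le_trans h; rewrite lerD2l lerN2.
Qed.

End SwapSearch.

(** * The local search algorithm *)

Section LocalSearch.
Variables (R : realType) (T : finType) (L : nat) (a : nat -> R) (ell : {set T} -> R).
Variables (W : Type) (pick : nat -> W -> {set elt T L} -> seq (elt T L) * seq (elt T L)).
Variable rounds : nat -> nat.
Local Notation elt := (elt T L).
Local Notation wt := (weight ell).
Implicit Types (A : {set elt}) (B V : seq elt) (u v : elt) (F : {set T} -> R) (r : nat).

Definition ask_indep (X : {set T}) (k : bool -> det_alg R T) := QueryIndep X k.
(** Whether [A] is colorful is known without a query, so one query to [M] decides independence in
    the colored matroid. *)
Definition ask_ext r A (k : bool -> det_alg R T) :=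
  QueryIndep (underlying A) (fun b => k (colorful r A && b)).

(** Both marginals are taken at [A] itself, so [size B + size V + 1] sets need evaluation rather
    than one for each pair. *)
Definition gain_in F A v := potential F a (v |: A) - potential F a A + wt v.
Definition gain_out F A u := potential F a A - potential F a (A :\ u) + wt u.
Definition probes (l : seq {set elt}) := [seq colored J X | X <- l, J <- enum {set 'I_L}].
Definition neighbors A B V := A :: [seq A :\ u | u <- B] ++ [seq v |: A | v <- V].
Definition sort_by (w : elt -> R) (s : seq elt) := sort (fun x y => w x <= w y) s.

Definition ask_round r A B V (k : R -> {set elt} -> det_alg R T) :=
  ask_values (probes (neighbors A B V)) (fun F =>
    ask_best_from (ask_ext r) A (gain_in F A) (gain_out F A) V
      (sort_by (gain_out F A) B) (0, A) (k (F (underlying A)))).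

Definition ask_first r A (k : {set elt} -> det_alg R T) :=
  ask_values (probes [seq [set v] | v <- enum {: elt}]) (fun F =>
    ask_best_from (ask_ext r) A (fun v => potential F a [set v] + wt v) wt (enum {: elt})
      (sort_by wt (enum A)) (0, A) k).

(** The number of rounds depends on the rank, which is unknown when the seeds are drawn; the seed
    list may be longer than [n], and its tail is ignored. *)
Fixpoint ask_loop r n A (ws : seq W) (k : {set T} * R -> det_alg R T) :=
  match n, ws with
  | n'.+1, w :: ws' => ask_round r A (pick r w A).1 (pick r w A).2 (fun x A' =>
      ask_loop r n' A' ws' (fun best =>
        let y := x + ell (underlying A) in
        k (if best.2 <= y then (underlying A, y) else best)))
  | _, _ => ask_values [:: underlying A] (fun F =>
      k (underlying A, F (underlying A) + ell (underlying A)))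
  end.

Definition by_weight := sort (fun x y : elt => wt y <= wt x) (enum {: elt}).

(** The first greedy pass serves to learn the rank, which fixes the number of rounds and the size of
    the bases of the colored matroid. *)
Definition local_search (ws : seq W) : det_alg R T :=
  ask_greedy ask_indep (enum T) set0 (fun I =>
    let r := #|I| in
    if r == 0 then Return R set0 else
    ask_greedy (ask_ext r) by_weight set0 (fun A0 =>
      ask_first r A0 (fun A1 =>
        ask_loop r (rounds r) A1 ws (fun best => Return R best.1)))).

Section Semantics.
Variables (f : {set T} -> R) (M : matroid T).
Local Notation N r := (ext_matroid M L r).

Lemma output_ask_ext r A k : output f M (ask_ext r A k) = output f M (k (A \in indep (N r))).
Proof. by rewrite /= inE. Qed.

Lemma queries_ask_ext r A k :
  queries f M (ask_ext r A k) = (queries f M (k (A \in indep (N r)))).+1.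
Proof. by rewrite /= inE. Qed.

Lemma mem_probes l X J : X \in l -> colored J X \in probes l.
Proof. by move=> Xl; apply/allpairsP; exists (X, J); rewrite mem_enum. Qed.

Lemma size_probes l : size (probes l) = (size l * #|{set 'I_L}|)%N.
Proof. by rewrite size_allpairs -cardE. Qed.

Lemma potential_table l X : X \in l -> potential (table f (probes l)) a X = potential f a X.
Proof. by move=> Xl; apply: eq_bigr => J _; rewrite tableE ?mem_probes. Qed.

Lemma mem_neighbors_del A B V u : u \in B -> A :\ u \in neighbors A B V.
Proof. by move=> uB; rewrite inE mem_cat (map_f (fun u => A :\ u) uB) orbT. Qed.

Lemma mem_neighbors_add A B V v : v \in V -> v |: A \in neighbors A B V.
Proof. by move=> vV; rewrite inE mem_cat (map_f (fun v => v |: A) vV) !orbT. Qed.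

Definition round r A B V :=
  let F := table f (probes (neighbors A B V)) in
  (best_from (N r) A (gain_in F A) (gain_out F A) V (sort_by (gain_out F A) B) (0, A)).2.

Lemma output_ask_round r A B V k :
  output f M (ask_round r A B V k) = output f M (k (f (underlying A)) (round r A B V)).
Proof.
rewrite output_ask_values (output_ask_best_from (output_ask_ext r)).
by rewrite tableE // -coloredT mem_probes ?mem_head.
Qed.

(** The binary search together with the query that precedes it. *)
Definition depth m := (trunc_log 2 m).+2.

Lemma queries_ask_round r A B V k : (queries f M (ask_round r A B V k) <=
  (size B + size V).+1 * #|{set 'I_L}| + size V * depth (size B) +
  queries f M (k (f (underlying A)) (round r A B V)))%N.
Proof.
rewrite queries_ask_values size_probes /= size_cat !size_map -addnA leq_add2l.
apply: leq_trans (queries_ask_best_from (queries_ask_ext r) _ _ _ _ _ _ _) _.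
by rewrite /search_depth size_sort tableE // -coloredT mem_probes ?mem_head.
Qed.

Definition first_round r A :=
  let F := table f (probes [seq [set v] | v <- enum {: elt}]) in
  (best_from (N r) A (fun v => potential F a [set v] + wt v) wt (enum {: elt})
    (sort_by wt (enum A)) (0, A)).2.

Lemma output_ask_first r A k :
  output f M (ask_first r A k) = output f M (k (first_round r A)).
Proof. by rewrite output_ask_values (output_ask_best_from (output_ask_ext r)). Qed.

Lemma queries_ask_first r A k : (queries f M (ask_first r A k) <=
  #|{: elt}| * #|{set 'I_L}| + #|{: elt}| * depth #|A| + queries f M (k (first_round r A)))%N.
Proof.
rewrite queries_ask_values size_probes size_map -cardE -addnA leq_add2l.
apply: leq_trans (queries_ask_best_from (queries_ask_ext r) _ _ _ _ _ _ _) _.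
by rewrite /search_depth size_sort -!cardE.
Qed.

Definition value A := f (underlying A) + ell (underlying A).

Fixpoint loop r n A (ws : seq W) : {set T} * R :=
  match n, ws with
  | n'.+1, w :: ws' =>
      let best := loop r n' (round r A (pick r w A).1 (pick r w A).2) ws' in
      if best.2 <= value A then (underlying A, value A) else best
  | _, _ => (underlying A, value A)
  end.

Lemma output_ask_loop r n A ws k :
  output f M (ask_loop r n A ws k) = output f M (k (loop r n A ws)).
Proof.
elim: n A ws k => [|n IH] A [|w ws] k; rewrite [ask_loop _ _ _ _ _]/= [loop _ _ _ _]/=;
  by rewrite ?output_ask_round ?IH //= eqxx.
Qed.

Lemma queries_ask_loop r n A ws k b c :
  (forall w A, (size (pick r w A).1 <= b)%N /\ (size (pick r w A).2 <= c)%N) ->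
  (queries f M (ask_loop r n A ws k) <=
    n * ((b + c).+1 * #|{set 'I_L}| + c * depth b) + 1 + queries f M (k (loop r n A ws)))%N.
Proof.
move=> le_pick; have end_case A' (k' : {set T} * R -> det_alg R T) :
    (queries f M (ask_values [:: underlying A'] (fun F =>
      k' (underlying A', F (underlying A') + ell (underlying A'))%R)) =
    1 + queries f M (k' (underlying A', value A')))%N.
  by rewrite queries_ask_values /= eqxx.
elim: n A ws k => [|n IH] A [|w ws] k; try by rewrite end_case leq_add2r leq_addl.
rewrite [ask_loop _ _ _ _ _]/=.
apply: leq_trans (queries_ask_round _ _ _ _ _) _.
have [le_b le_c] := le_pick w A.
rewrite [(n.+1 * _)%N]mulSn -[X in (_ <= X)%N]addnA -[X in (_ <= X)%N]addnA; apply: leq_add.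
  apply: leq_add; first by apply: leq_mul => //; rewrite ltnS leq_add.
  by apply: leq_mul => //; rewrite !ltnS leq_trunc_log.
by rewrite addnA; apply: IH.
Qed.

Definition rank_of := #|greedy M (enum T)|.

Definition result ws : {set T} :=
  if rank_of == 0 then set0 else
  (loop rank_of (rounds rank_of) (first_round rank_of (greedy (N rank_of) by_weight)) ws).1.

Lemma output_local_search ws : output f M (local_search ws) = result ws.
Proof.
rewrite (@output_ask_greedy _ _ f M _ M) // /result /rank_of /greedy; case: ifP => // _.
by rewrite (output_ask_greedy (output_ask_ext _)) output_ask_first output_ask_loop.
Qed.

Lemma queries_local_search ws b c :
  (forall w A, (size (pick rank_of w A).1 <= b)%N /\ (size (pick rank_of w A).2 <= c)%N) ->
  (queries f M (local_search ws) <= #|T| + (0 < rank_of) *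
    (#|{: elt}| + (#|{: elt}| * #|{set 'I_L}| +
      #|{: elt}| * depth #|greedy (N rank_of) by_weight|) +
    (rounds rank_of * ((b + c).+1 * #|{set 'I_L}| + c * depth b) + 1)))%N.
Proof.
move=> le_pick; rewrite (@queries_ask_greedy _ _ f M _ M) // -cardE leq_add2l -/(greedy M _).
rewrite -/rank_of; cbv beta zeta; rewrite -/rank_of.
case: ifPn => [_|]; [exact: leq0n|rewrite -lt0n => ->; rewrite mul1n].
rewrite (queries_ask_greedy (queries_ask_ext _)) size_sort -cardE.
rewrite -addnA leq_add2l; apply: leq_trans (queries_ask_first _ _ _) _.
rewrite leq_add2l; apply: leq_trans (queries_ask_loop _ _ _ _ le_pick) _.
by rewrite addn0.
Qed.

End Semantics.
End LocalSearch.

(** * Progress of one round *)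

Lemma sum_swap (R : realType) (E : finType) (N : matroid E) (w : E -> R) (A : {set E}) u v :
  is_base N A -> is_base N (v |: A :\ u) -> u \in A ->
  \sum_(x in v |: A :\ u) w x = \sum_(x in A) w x - w u + w v.
Proof.
move=> bA bA' uA; case: (boolP (v \in A :\ u)) => vA.
  have := base_card bA' bA; rewrite (setUidPr _) ?sub1set // [RHS](cardsD1 u A) uA => /eqP.
  by rewrite add1n eqn_leq ltnn andbF.
by rewrite big_setU1 // [in RHS](big_setD1 u) //=; ring.
Qed.

Section Rounds.
Variables (R : realType) (T : finType) (L : nat) (a : nat -> R) (ell : {set T} -> R).
Variables (f : {set T} -> R) (M : matroid T) (r : nat).
Hypotheses (f_ge0 : setfun_nonneg f) (f_mono : setfun_monotone f)
  (f_sub : setfun_submodular f) (a_ge0 : forall i, 0 <= a i).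
Local Notation elt := (elt T L).
Local Notation wt := (weight ell).
Local Notation N := (ext_matroid M L r).
Implicit Types (A B : {set elt}).

Definition Psi A := potential f a A + \sum_(x in A) wt x.

Lemma sort_by_sorted (w : elt -> R) (s : seq elt) :
  sorted (fun x y => w x <= w y) (sort_by w s).
Proof. by apply: sort_sorted => x y; apply: le_total. Qed.

(** The table agrees with [f] on all probed sets, and [submodular_swap] makes each score a lower
    bound for the change of [Psi]. *)
Lemma round_spec A (B V : seq elt) : is_base N A -> {subset B <= A} ->
  let A' := round a ell f M r A B V in
  [/\ is_base N A', Psi A <= Psi A' & forall u v, u \in B -> v \in V ->
    is_base N (v |: A :\ u) ->
    gain_in a ell f A v - gain_out a ell f A u <= Psi A' - Psi A].
Proof.
move=> bA sBA; rewrite /round; set l := probes _; set F := table f l.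
have giE v : v \in V -> gain_in a ell F A v = gain_in a ell f A v.
  by move=> vV; rewrite /gain_in !potential_table ?mem_head ?mem_neighbors_add.
have goE u : u \in B -> gain_out a ell F A u = gain_out a ell f A u.
  by move=> uB; rewrite /gain_out !potential_table ?mem_head ?mem_neighbors_del.
have s_sort : {subset sort_by (gain_out a ell F A) B <= A}.
  by move=> u; rewrite mem_sort; apply: sBA.
have swap u v : u \in sort_by (gain_out a ell F A) B -> v \in V ->
    is_base N (v |: A :\ u) ->
    gain_in a ell F A v - gain_out a ell F A u <= Psi (v |: A :\ u) - Psi A.
  rewrite mem_sort => uB vV bA'; rewrite giE // goE // /Psi (sum_swap wt bA bA' (sBA _ uB)).
  have := submodular_swap (potential_sub f_mono f_sub a_ge0)
    (potential_mono f_mono a_ge0) v (sBA _ uB).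
  rewrite /gain_in /gain_out; lra.
have [|b1 b2 b3 b4] := best_from_spec bA (G := fun X => Psi X - Psi A)
  (cur := (0, A)) (sort_by_sorted _ _) s_sort swap bA; first by rewrite /= subrr.
split=> //; first by rewrite -subr_ge0; apply: le_trans b2.
move=> u v uB vV bA'; apply: le_trans b2; rewrite -giE // -goE //.
by apply: b4; rewrite ?mem_sort.
Qed.

Lemma first_round_spec A : is_base N A ->
  let A' := first_round a ell f M r A in
  [/\ is_base N A', 0 <= Psi A' - \sum_(x in A) wt x & forall u v, u \in A ->
    is_base N (v |: A :\ u) ->
    potential f a [set v] + wt v - wt u <= Psi A' - \sum_(x in A) wt x].
Proof.
move=> bA; rewrite /first_round; set l := probes _; set F := table f l.
have FE (v : elt) : potential F a [set v] = potential f a [set v].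
  by rewrite potential_table //; apply/map_f; rewrite mem_enum.
have s_sort : {subset sort_by wt (enum A) <= A}.
  by move=> u; rewrite mem_sort mem_enum.
have swap u v : u \in sort_by wt (enum A) -> v \in enum {: elt} ->
    is_base N (v |: A :\ u) -> potential F a [set v] + wt v - wt u <=
      Psi (v |: A :\ u) - \sum_(x in A) wt x.
  move=> /s_sort uA _ bA'; rewrite FE /Psi (sum_swap wt bA bA' uA).
  have := potential_mono f_mono a_ge0 (subsetUl [set v] (A :\ u)); lra.
have [|b1 b2 b3 b4] := best_from_spec bA (G := fun X => Psi X - \sum_(x in A) wt x)
  (cur := (0, A)) (sort_by_sorted _ _) s_sort swap bA.
  by rewrite /= /Psi addrK potential_ge0.
split=> //; first exact: le_trans b2.
move=> u v uA bA'; apply: le_trans b2; rewrite -FE.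
by apply: b4; rewrite ?mem_sort ?mem_enum.
Qed.

Lemma exchange_base A O : is_base N A -> is_base N O -> exists p : elt -> elt,
  [/\ {in O, forall v, p v \in A}, {in O &, injective p},
    {in O, forall v, is_base N (v |: A :\ p v)} &
    forall w : elt -> R, \sum_(v in O) w (p v) = \sum_(u in A) w u].
Proof.
move=> bA bO; have [p [pA pinj pid pI]] := base_exchange_injection bA bO.1.
exists p; split=> //.
  move=> v vO; case: (boolP (v \in A)) => vA; first by rewrite pid // setD1K.
  by split; [apply: pI | move=> Y /bA.2; rewrite swap_card ?pA].
have im : p @: O = A.
  apply/eqP; rewrite eqEcard card_in_imset // (base_card bA bO) leqnn andbT.
  by apply/subsetP => _ /imsetP[v vO ->]; apply: pA.
by move=> w; rewrite -[in RHS]im big_imset.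
Qed.

Variables (b c : R).
Hypotheses (L_gt0 : (0 < L)%N)
  (a_rec : forall i, (0 < i < L)%N -> L.+1%:R * i%:R * a i = L%:R * (L - i)%:R * a i.+1)
  (a_top : L.+1%:R * a L = c)
  (a_sum : \sum_(J : {set 'I_L}) #|J|%:R * a #|J| = L%:R * b).
Hypotheses (ell_lin : setfun_linear ell) (r_le : (r <= #|T|)%N).

(** [S] is painted in the color given by [potential_local] and padded with dummies to a base [O]. A
    bijection from [O] to [A] then turns the difference of the two sums of marginals into a sum over
    swaps. *)
Lemma exchange_gain A (S : {set T}) : is_base N A -> S \in indep M -> (#|S| <= r)%N ->
  exists (O : {set elt}) (p : elt -> elt),
  [/\ {in O, forall v, p v \in A}, {in O &, injective p},
    {in O, forall v, is_base N (v |: A :\ p v)} &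
    b * f S - c * f (underlying A) + ell S - ell (underlying A) <=
    \sum_(v in O) (gain_in a ell f A v - gain_out a ell f A (p v))].
Proof.
move=> bA Si Sr; have [k Hk] :=
  potential_local f_ge0 f_mono f_sub a_ge0 L_gt0 a_rec a_top a_sum A S.
have [O [Oi cO sO uO]] := painted_base k Si Sr r_le.
have [p [p1 p2 p3 p4]] := exchange_base bA (ext_baseE Oi cO).
exists O, p; split=> //; rewrite sumrB (p4 (gain_out a ell f A)).
rewrite [X in _ <= X - _]big_split [X in _ <= _ - X]big_split /=.
rewrite (weight_sum ell_lin Oi) (weight_sum ell_lin bA.1) uO.
have := Hk O sO; lra.
Qed.

(** The potential of [O] is at most the sum of those of its [r] singletons. Pairing [O] with [A]
    splits the left side into [r] swap scores, each at most the result of the first round. *)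
Lemma first_round_max A O : is_base N A -> is_base N O -> (0 < r)%N ->
  Psi O - \sum_(x in A) wt x <= r%:R * (Psi (first_round a ell f M r A) - \sum_(x in A) wt x).
Proof.
move=> bA bO r0; have [_ _ H] := first_round_spec bA.
have [p [p1 p2 p3 p4]] := exchange_base bA bO.
have cO : #|O| = r by apply: ext_base_card bO.
apply: (@le_trans _ _ (\sum_(v in O) (potential f a [set v] + wt v - wt (p v)))); last first.
  rewrite mulr_natl -[X in _ *+ X]cO -sumr_const; apply: ler_sum => v vO.
  by apply: H; [apply: p1 | apply: p3].
rewrite sumrB (p4 wt) big_split /= lerD2r lerD2r.
have e : \sum_(v in O) (potential f a (v |: set0) - potential f a (set0 : {set elt})) =
    \sum_(v in O) potential f a [set v] - potential f a (set0 : {set elt}) *+ r.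
  by rewrite sumrB sumr_const cO; congr (_ - _); apply: eq_bigr => v _; rewrite setU0.
have := submodular_sum_add (potential_sub f_mono f_sub a_ge0) set0 O.
rewrite set0U e.
have p0 : 0 <= potential f a (set0 : {set elt}) by apply: potential_ge0.
(* The potential of [set0] may be positive. The marginals at [set0] subtract it [r] times, which
   outweighs its single occurrence on the other side because [0 < r]. *)
have : potential f a (set0 : {set elt}) <= potential f a (set0 : {set elt}) *+ r.
  by rewrite -[r]prednK // mulrS lerDl mulrn_wge0.
lra.
Qed.

End Rounds.

(** * Averages over seeds *)

Section Mean.
Variable R : realType.

Definition mean (W : finType) (X : W -> R) : R := (\sum_w X w) / #|W|%:R.

Lemma mean_cst (W : finType) (x : R) : (0 < #|W|)%N -> mean (fun _ : W => x) = x.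
Proof.
by move=> W0; rewrite /mean sumr_const -[x *+ _]mulr_natr mulfK // pnatr_eq0 -lt0n.
Qed.

Lemma ler_mean (W : finType) (X Y : W -> R) : (forall w, X w <= Y w) -> mean X <= mean Y.
Proof. by move=> XY; rewrite ler_wpM2r ?invr_ge0 // ler_sum. Qed.

Lemma meanD (W : finType) (X Y : W -> R) : mean (fun w => X w + Y w) = mean X + mean Y.
Proof. by rewrite /mean big_split mulrDl. Qed.

Lemma meanZ (W : finType) (c : R) (X : W -> R) : mean (fun w => c * X w) = c * mean X.
Proof. by rewrite /mean -mulr_sumr mulrA. Qed.

Lemma mean_affine (W : finType) (c d : R) (X : W -> R) : (0 < #|W|)%N ->
  mean (fun w => c + d * X w) = c + d * mean X.
Proof. by move=> W0; rewrite meanD meanZ mean_cst. Qed.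

Fixpoint seeds (W : finType) (m : nat) : finType :=
  if m is m'.+1 then (W * seeds W m')%type : finType else unit.

Fixpoint seed_seq (W : finType) (m : nat) : seeds W m -> seq W :=
  if m is m'.+1 then fun s => s.1 :: seed_seq s.2 else fun=> [::].

Lemma card_seeds_gt0 (W : finType) (m : nat) : (0 < #|W|)%N -> (0 < #|seeds W m|)%N.
Proof. by move=> W0; elim: m => [|m IH] /=; rewrite ?card_unit // card_prod muln_gt0 W0. Qed.

Lemma mean_prod (V W : finType) (X : V * W -> R) :
  mean X = mean (fun v => mean (fun w => X (v, w))).
Proof.
rewrite /mean -mulr_suml card_prod natrM pair_bigA /= invfM [_^-1 * _]mulrC mulrA.
by congr (_ / _ / _); apply: eq_bigr => -[].
Qed.

(** * Best value met by a process whose potential grows geometrically *)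

Section Process.
Variables (W : finType) (X : Type) (good : X -> Prop) (step : W -> X -> X).
Variables (val pot : X -> R) (best : nat -> X -> seq W -> R) (rho th tau Pmax : R).
Hypotheses (W_gt0 : (0 < #|W|)%N) (rho_gt0 : 0 < rho) (th_ge0 : 0 <= th).
Hypotheses (best_ge : forall n x ws, val x <= best n x ws)
  (best_step : forall n x w ws, best n (step w x) ws <= best n.+1 x (w :: ws))
  (good_step : forall w x, good x -> good (step w x))
  (pot_le : forall x, good x -> pot x <= Pmax)
  (pot_step : forall x, good x ->
    rho * (tau - val x + th * pot x) <= mean (fun w => pot (step w x)) - pot x).

(** While [val x <= tau], one step multiplies the expected potential by at least [q]. *)
Let q := 1 + rho * th.
Let geom n := \sum_(i < n) q ^+ i.

(* Weighting the state reached after [n - i] steps by [q ^+ i] makes [pot_step] telescope. *)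
Lemma mean_best_geom n m x : good x -> (n <= m)%N ->
  geom n.+1 * tau + (q ^+ n.+1 * pot x - Pmax) / rho <=
  geom n.+1 * mean (fun s : seeds W m => best n x (seed_seq s)).
Proof.
have q0 : 0 <= q by rewrite addr_ge0 // mulr_ge0 // ltW.
have pot_step' y : good y ->
    tau + (q * pot y - mean (fun w => pot (step w y))) / rho <= val y.
  move=> gy; have := pot_step gy; rewrite -ler_pdivlMl //; move: (mean _) => z.
  have -> : (q * pot y - z) / rho = th * pot y - rho^-1 * (z - pot y).
    by rewrite /q; field; rewrite lt0r_neq0.
  by move: (rho^-1 * _) => w; lra.
elim: n m x => [|n IH] m x gx.
  move=> _; rewrite /geom big_ord1 expr0 !mul1r expr1.
  have : val x <= mean (fun s : seeds W m => best 0 x (seed_seq s)).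
    rewrite -[val x](@mean_cst (seeds W m)) ?card_seeds_gt0 //.
    by apply: ler_mean => s; apply: best_ge.
  apply: le_trans; apply: le_trans (pot_step' x gx); rewrite lerD2l ler_pM2r ?invr_gt0 //.
  rewrite lerD2l lerN2 -[Pmax](@mean_cst W) //; apply: ler_mean => w.
  exact/pot_le/good_step.
case: m => [//|m]; rewrite ltnS => le_nm.
rewrite mean_prod; set B := mean _.
have B1 : val x <= B.
  rewrite -[val x](@mean_cst W) //; apply: ler_mean => w.
  rewrite -[val x](@mean_cst (seeds W m)) ?card_seeds_gt0 //.
  by apply: ler_mean => s; apply: best_ge.
have B2 : geom n.+1 * tau + (q ^+ n.+1 * mean (fun w => pot (step w x)) - Pmax) / rho <=
    geom n.+1 * B.
  rewrite [X in X <= _](_ : _ = geom n.+1 * tau - Pmax / rho +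
    q ^+ n.+1 / rho * mean (fun w => pot (step w x))); last by ring.
  rewrite -mean_affine // -meanZ; apply: ler_mean => w.
  rewrite [X in X <= _](_ : _ = geom n.+1 * tau + (q ^+ n.+1 * pot (step w x) - Pmax) / rho);
    last by ring.
  apply: le_trans (IH m _ (good_step w gx) le_nm) _.
  rewrite ler_wpM2l ?sumr_ge0 // => [i _|]; first exact: exprn_ge0.
  by apply: ler_mean => s; apply: best_step.
rewrite /geom big_ord_recr /= -/(geom _) !mulrDl.
have B3 := ler_wpM2l (exprn_ge0 n.+1 q0) (le_trans (pot_step' x gx) B1).
apply: le_trans (lerD B2 B3); rewrite le_eqVlt; apply/orP; left; apply/eqP.
by rewrite [q ^+ n.+2]exprS; field; rewrite lt0r_neq0.
Qed.

Lemma mean_best n m x : good x -> (n <= m)%N -> Pmax <= q ^+ n.+1 * pot x ->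
  tau <= mean (fun s : seeds W m => best n x (seed_seq s)).
Proof.
move=> gx le_nm hP; have q0 : 0 <= q by rewrite addr_ge0 // mulr_ge0 // ltW.
have g0 : 0 < geom n.+1.
  by rewrite /geom big_ord_recl expr0 ltr_pwDl // sumr_ge0 // => i _; apply: exprn_ge0.
rewrite -(ler_pM2l g0); apply: le_trans (mean_best_geom gx le_nm).
by rewrite lerDl divr_ge0 ?subr_ge0 // ltW.
Qed.

End Process.
End Mean.

(** * Choosing candidate swaps *)

Fixpoint isqrt n := if n is n'.+1 then
    let s := isqrt n' in if (s.+1 * s.+1 <= n)%N then s.+1 else s
  else 0%N.

Lemma isqrt_spec n : (isqrt n * isqrt n <= n < (isqrt n).+1 * (isqrt n).+1)%N.
Proof. by elim: n => //= n IH; case: ifPn; nia. Qed.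

Section Sampling.
Variables (R : realType).

Lemma sum_nat_mod_ge (F : nat -> R) (m q : nat) : (forall i, 0 <= F i) -> (0 < q)%N ->
  (m %/ q)%:R * \sum_(j < q) F j <= \sum_(i < m) F (i %% q)%N.
Proof.
move=> F0 q0; have mult k : \sum_(0 <= i < k * q) F (i %% q)%N = k%:R * \sum_(j < q) F j.
  elim: k => [|k IH]; first by rewrite mul0n big_geq // mul0r.
  rewrite mulSn addnC (@big_cat_nat _ _ _ (k * q)%N) ?leq_addr //= IH -natr1 mulrDl mul1r.
  congr (_ + _); rewrite -{1}[(k * q)%N]add0n big_addn addKn big_mkord; apply: eq_bigr => j _.
  by rewrite addnC modnMDl modn_small.
rewrite -mult -(big_mkord xpredT (fun i => F (i %% q)%N)).
rewrite [X in _ <= X](@big_cat_nat _ _ _ (m %/ q * q)%N) ?leq_trunc_div //= lerDl.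
by apply: sumr_ge0.
Qed.

(** Each residue modulo [q] is hit at least [#|W| %/ q] times, and [q <= #|W|] makes this at least
    [#|W| / (2 * q)]. A seed type of arbitrary size can thus choose one of [q] blocks almost
    uniformly. *)
Lemma mean_mod_ge (W : finType) (F : nat -> R) (q : nat) : (forall i, 0 <= F i) ->
  (0 < q <= #|W|)%N ->
  (2 * q)%:R^-1 * \sum_(j < q) F j <= mean (fun x : W => F (enum_rank x %% q)%N).
Proof.
move=> F0 /andP[q0 qW]; rewrite /mean.
have -> : \sum_(x : W) F (enum_rank x %% q)%N = \sum_(i < #|W|) F (i %% q)%N.
  rewrite (reindex (@enum_val W W)) /=; last by apply/onW_bij/enum_val_bij.
  by apply: eq_big => [i|i _]; rewrite ?enum_valP ?enum_valK.
have W0 : 0 < #|W|%:R :> R by rewrite ltr0n (leq_trans q0).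
rewrite ler_pdivlMr //; apply: le_trans (sum_nat_mod_ge _ F0 q0).
rewrite mulrAC ler_wpM2r ?sumr_ge0 // ler_pdivrMl ?ltr0n ?muln_gt0 //.
rewrite -natrM ler_nat.
have := divn_eq #|W| q; have := ltn_pmod #|W| q0.
have : (0 < #|W| %/ q)%N by rewrite divn_gt0.
nia.
Qed.

Fixpoint seq_max (W : Type) (z : W -> R) (s : seq W) : R :=
  if s is w :: s' then Num.max (z w) (seq_max z s') else 0.

Lemma seq_max_ge0 (W : Type) (z : W -> R) s : 0 <= seq_max z s.
Proof. by elim: s => //= w s IH; rewrite le_max IH orbT. Qed.

(* Each draw contributes its value unless a later draw also hits the support. *)
Lemma mean_seq_max (W : finType) (z : W -> R) (m a : nat) : (forall w, 0 <= z w) ->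
  (0 < #|W|)%N -> (a <= m)%N ->
  mean z * (a%:R - #|[set w | z w != 0]|%:R / #|W|%:R * a%:R ^+ 2 / 2) <=
  mean (fun s : seeds W m => seq_max z (take a (seed_seq s))).
Proof.
move=> z0 W0; set mu := #|_|%:R / #|W|%:R.
have W0' : 0 < #|W|%:R :> R by rewrite ltr0n.
have mu1 : mu <= 1 by rewrite ler_pdivrMr // mul1r ler_nat max_card.
have mu0 : 0 <= mu by rewrite divr_ge0.
have mz0 : 0 <= mean z by rewrite divr_ge0 ?sumr_ge0.
elim: a m => [|a IH] m le_am.
  rewrite expr0n mulr0 mul0r subr0 mulr0.
  by rewrite divr_ge0 // sumr_ge0 // => s _; apply: seq_max_ge0.
case: m le_am => // m; rewrite ltnS => le_am.
rewrite mean_prod; set B := mean (fun s : seeds W m => seq_max z (take a (seed_seq s))).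
(* Condition on the first draw: keep its value if it is nonzero, and otherwise the maximum of the
   later draws. *)
apply: (@le_trans _ _ (mean (fun w => z w + B * (z w == 0)%:R))); last first.
  apply: ler_mean => w.
  case: eqP => [->|_]; rewrite ?add0r ?mulr1 ?mulr0 ?addr0.
    by apply: ler_mean => s /=; rewrite le_max lexx orbT.
  rewrite -[z w in X in X <= _](@mean_cst _ (seeds W m)) ?card_seeds_gt0 //.
  by apply: ler_mean => s /=; rewrite le_max lexx.
rewrite meanD meanZ.
have -> : mean (fun w : W => (z w == 0)%:R) = 1 - mu :> R.
  rewrite /mean (eq_bigr (fun w => 1 - (if z w != 0 then 1 else 0))); last first.
    by move=> w _; case: eqP; rewrite ?subr0 ?subrr.
  rewrite sumrB sumr_const -big_mkcond /= sumr_const mulrBl divff ?lt0r_neq0 //.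
  by rewrite /mu cardsE.
have {IH} := IH m le_am; rewrite -/B => IH.
have h1 : mean z * (a%:R - mu * a%:R ^+ 2 / 2) * (1 - mu) <= B * (1 - mu).
  by rewrite ler_wpM2r // subr_ge0.
(* This is exactly the surplus that remains once [B] is replaced by its lower bound. *)
have h2 : 0 <= mean z * (mu ^+ 2 * a%:R ^+ 2 / 2 + mu / 2).
  by apply: mulr_ge0 => //; apply: addr_ge0; rewrite divr_ge0 // mulr_ge0 // exprn_ge0.
rewrite -natr1; nra.
Qed.

(** As [a] times the size of the support is at most [#|W|], repeated hits lose at most half of the
    first-order term. *)
Lemma mean_max_half (W : finType) (z : W -> R) (m a : nat) (H : seeds W m -> R) :
  (forall w, 0 <= z w) -> (0 < #|W|)%N -> (a <= m)%N ->
  (a * #|[set w | z w != 0%R]| <= #|W|)%N ->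
  (forall s, 0 <= H s) -> (forall s w, w \in take a (seed_seq s) -> z w <= H s) ->
  a%:R / 2 * mean z <= mean H.
Proof.
move=> z0 W0 am le_supp H0 HH; apply: le_trans (_ : _ <= mean (fun s : seeds W m =>
  seq_max z (take a (seed_seq s)))) _; last first.
  apply: ler_mean => s; have := HH s; elim: (take _ _) => //= w l IH Hl.
  by rewrite ge_max Hl ?mem_head //= IH // => w' w'l; rewrite Hl // inE w'l orbT.
apply: le_trans (mean_seq_max z0 W0 am).
have mz0 : 0 <= mean z by rewrite divr_ge0 ?sumr_ge0.
rewrite mulrC ler_wpM2l // expr2 mulrA.
have : #|[set w | z w != 0]|%:R / #|W|%:R * a%:R <= 1 :> R.
  by rewrite mulrAC ler_pdivrMr ?ltr0n // mul1r -natrM ler_nat mulnC.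
have : 0 <= a%:R :> R by [].
move: (_ * a%:R) => t; nra.
Qed.


(* [G w] stands for the progress of a round with seed [w], which is at least [y v] if the swap
   of [v] and [p v] is among the candidates. *)
Definition fair_pick (E W : finType) (r : nat) (pick : W -> {set E} -> seq E * seq E) :=
  forall (A O : {set E}) (p : E -> E) (y : E -> R) (G : W -> R),
  #|A| = r -> {in O, forall v, p v \in A} -> {in O &, injective p} ->
  (forall v, 0 <= y v) -> (forall w, 0 <= G w) ->
  (forall w v, v \in O -> p v \in (pick w A).1 -> v \in (pick w A).2 -> y v <= G w) ->
  (16 * r%:R)^-1 * \sum_(v in O) y v <= mean G.

Variable E : finType.

(** When [#|A| = r] the truncation removes nothing; it makes the size bound hold for every [A]. *)
Definition full_pick (r : nat) (_ : unit) (A : {set E}) := (take r (enum A), enum E).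

Lemma full_pick_fair r : fair_pick r (full_pick r).
Proof.
move=> A O p y G cA pA p_inj y0 G0 HG.
rewrite /mean card_unit divr1 (big_pred1 tt) => [|[]] //.
have le_G : \sum_(v in O) y v <= r%:R * G tt.
  apply: (@le_trans _ _ (\sum_(v in O) G tt)).
    by apply: ler_sum => v vO; apply: HG; rewrite //= ?take_oversize -?cardE ?cA ?mem_enum ?pA.
  rewrite sumr_const -[X in X <= _]mulr_natl ler_wpM2r // ler_nat -cA -(card_in_imset p_inj).
  by apply/subset_leq_card/subsetP => _ /imsetP[v vO ->]; apply: pA.
case: (posnP r) => [r0|r_gt0]; first by rewrite r0 mulr0 invr0 mul0r.
rewrite ler_pdivrMl ?mulr_gt0 ?ltr0n //; apply: le_trans le_G _.
by have := mulr_ge0 (ler0n R r) (G0 tt); lra.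
Qed.

Local Notation m := #|{: option E}|.
Definition block_size r := minn r (isqrt m).
Definition draws r := (m %/ block_size r)%N.
Definition blocks r := (r %/ block_size r).+1.
Definition block r j (A : {set E}) := take (block_size r) (drop (j * block_size r) (enum A)).
(** The seed type cannot depend on the rank, so it holds [m] draws, enough for every block size.
    With [option E] there is always something to draw; [None] proposes no element. *)
Definition sample_seed : finType := (option E * seeds (option E) m)%type.
Definition sample_pick r (w : sample_seed) (A : {set E}) :=
  (block r (enum_rank w.1 %% blocks r)%N A, pmap id (take (draws r) (seed_seq w.2))).

Lemma block_size_gt0 r : (0 < r)%N -> (0 < block_size r)%N.
Proof.
move=> r0; rewrite leq_min r0 /=; have := isqrt_spec m; rewrite card_option.
by case: (isqrt _).
Qed.

Lemma mem_block r (A : {set E}) u : (0 < r)%N -> #|A| = r -> u \in A ->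
  exists2 j : 'I_(blocks r), true & u \in block r j A.
Proof.
move=> r0 cA uA; have b0 := block_size_gt0 r0.
have lt_i : (index u (enum A) < r)%N by rewrite -cA cardE index_mem mem_enum.
have lt_j : (index u (enum A) %/ block_size r < blocks r)%N.
  by rewrite ltnS leq_div2r // ltnW.
exists (Ordinal lt_j) => //=.
have uE : u \in enum A by rewrite mem_enum.
rewrite -[u in u \in _](nth_index u uE) /block.
set i := index u _ in lt_i lt_j *.
have := divn_eq i (block_size r); set j := (_ %/ _)%N => iE.
have lt_m : (i %% block_size r < block_size r)%N by rewrite ltn_pmod.
rewrite iE -nth_drop -(nth_take u lt_m) mem_nth // size_take size_drop -cardE cA.
by case: ifP => // _; rewrite ltn_subRL -iE.
Qed.

(* With [draws r * block_size r <= m], the pairs [(v, p v)] falling in one block are few enough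
   for the draws to hit mostly distinct ones, so little is lost by keeping only the best. *)
Lemma sample_pick_fair r : (0 < r)%N -> (r <= #|E|)%N -> fair_pick r (sample_pick r).
Proof.
move=> r0 rE A O p y G cA pA p_inj y0 G0 HG.
have b0 := block_size_gt0 r0; set b := block_size r in b0.
have m_gt0 : (0 < m)%N by rewrite card_option.
have le_br : (b <= r)%N by apply: geq_minl.
have rm : (r < m)%N by rewrite card_option ltnS.
have le_bm : (b <= m)%N by apply: leq_trans le_br (ltnW rm).
pose z j (w : option E) := if w is Some v then
  if (v \in O) && (p v \in block r j A) then y v else 0 else 0.
have z0 j w : 0 <= z j w by case: w => //= v; case: ifP.
pose F j := (draws r)%:R / 2 * mean (z j).
have F0 j : 0 <= F j by rewrite mulr_ge0 ?divr_ge0 // sumr_ge0.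
have half x : F (enum_rank x %% blocks r)%N <= mean (fun s => G (x, s)).
  apply: (mean_max_half (z0 _) m_gt0 (leq_div _ _)) => //; last first.
    move=> s [v|] ws /=; last exact: G0.
    case: ifP => [/andP[vO vb]|_]; last exact: G0.
    by apply: HG => //=; rewrite mem_pmap; apply/mapP; exists (Some v).
  (* Since [p] is injective, at most [b] elements have their partner in the chosen block. *)
  apply: leq_trans (leq_trunc_div m b); rewrite leq_mul2l; apply/orP; right.
  set j := (_ %% _)%N; pose D := [set v in O | p v \in block r j A].
  apply: (@leq_trans #|[set Some v | v in D]|).
    apply/subset_leq_card/subsetP => -[v|]; rewrite inE /= ?eqxx //.
    case: ifP => [vD _|]; rewrite ?eqxx //; apply/imsetP; exists v => //.
    by rewrite inE.
  rewrite card_imset; last by move=> ? ? [].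
  have p_injD : {in D &, injective p}.
    by move=> u v; rewrite !inE => /andP[uO _] /andP[vO _]; apply: p_inj.
  rewrite -(card_in_imset p_injD).
  apply: (@leq_trans (size (block r j A))); last first.
    by rewrite size_take_min geq_minl.
  apply: leq_trans (card_size _); apply/subset_leq_card/subsetP => _ /imsetP[v + ->].
  by rewrite inE => /andP[].
have le_blocks : (0 < blocks r <= m)%N.
  by rewrite /= (leq_trans _ rm) // ltnS leq_div.
rewrite mean_prod; apply: le_trans (ler_mean half); apply: le_trans (mean_mod_ge F0 le_blocks).
have sumF : (draws r)%:R / 2 / m%:R * \sum_(v in O) y v <= \sum_(j < blocks r) F j.
  rewrite -mulr_sumr -mulrA ler_wpM2l ?divr_ge0 // /mean -mulr_suml mulrC.
  rewrite ler_wpM2r ?invr_ge0 //.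
  apply: (@le_trans _ _ (\sum_(j < blocks r) \sum_(v in O) z j (Some v))); last first.
    apply: ler_sum => j _; rewrite -(big_imset (z j)) /=; last by move=> ? ? _ _ [].
    rewrite big_mkcond; apply: ler_sum => w _.
    by case: ifP.
  rewrite exchange_big; apply: ler_sum => v vO.
  have [j _ vj] := mem_block r0 cA (pA v vO).
  rewrite (bigD1 j) //= vO vj /= lerDl; apply: sumr_ge0 => i _.
  by case: ifP.
apply: le_trans (_ : (2 * blocks r)%:R^-1 * ((draws r)%:R / 2 / m%:R * \sum_(v in O) y v) <= _).
  rewrite mulrA ler_wpM2r ?sumr_ge0 //.
  have mR : 0 < m%:R :> R by rewrite ltr0n.
  have qR : 0 < (blocks r)%:R :> R by [].
  have rR : 0 < r%:R :> R by rewrite ltr0n.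
  (* Rounding in [draws] and in [blocks] each costs a factor 2. Together with 2 from [mean_mod_ge]
     and 2 from [mean_max_half] this gives the constant 16. *)
  have key : (blocks r * m <= 4 * r * draws r)%N.
    have d0 : (0 < draws r)%N by rewrite divn_gt0.
    have h1 : (m <= 2 * (draws r * b))%N.
      have := divn_eq m b; have := ltn_pmod m b0; rewrite /draws -/b in d0 *; nia.
    have h2 : (blocks r * b <= 2 * r)%N.
      have := leq_trunc_div r b; rewrite /blocks -/b mulSn; lia.
    move: h1 h2; move: (draws r) (blocks r) => d q h1 h2.
    apply: leq_trans (leq_mul (leqnn q) h1) _.
    by have := leq_mul (leqnn (2 * d)%N) h2; lia.
  have : (blocks r)%:R * m%:R <= 4 * r%:R * (draws r)%:R :> R by rewrite -!natrM ler_nat.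
  rewrite natrM; move: (draws r)%:R (blocks r)%:R qR m%:R mR => d q qR k mR hd.
  rewrite [X in _ <= X](_ : _ = d / (4 * (q * k))); last by field; rewrite !lt0r_neq0.
  by rewrite ler_pdivlMr ?mulr_gt0 // ler_pdivrMl ?mulr_gt0 //; lra.
by rewrite ler_wpM2l ?invr_ge0.
Qed.

End Sampling.

(** * Quality of the output *)

Section SearchConstants.
Variables (R : realType) (eps : R).

Definition parts := (Num.truncn (2 / eps)).+1.
Definition alpha := coef (eps / 2) parts.
Definition coef_total := \sum_(J : {set 'I_parts}) alpha #|J|.
(* Chosen so that [theta] times the potential of a base is at most [f] times the slack left by
   the factor [(1 + eps / 2)^-1] in the coefficients. *)
Definition theta := (1 - (1 + eps / 2)^-1) / (1 + coef_total).
Definition round_factor := (Num.truncn (16 / theta)).+1.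
Definition rounds r := (round_factor * r * (trunc_log 2 r).+1)%N.

Hypothesis eps_gt0 : 0 < eps.

Let delta_ge0 : 0 <= eps / 2. Proof. by rewrite divr_ge0 // ltW. Qed.

Lemma alpha_ge0 i : 0 <= alpha i.
Proof. exact: coef_ge0. Qed.

Lemma coef_total_ge0 : 0 <= coef_total.
Proof. by apply: sumr_ge0 => J _; apply: alpha_ge0. Qed.

Lemma theta_gt0 : 0 < theta.
Proof.
apply: divr_gt0; last by rewrite ltr_pwDl ?coef_total_ge0.
have d0 : 0 < eps / 2 by rewrite divr_gt0.
by rewrite subr_gt0 invf_lt1 ?ltrDl // ltr_pwDl // ltW.
Qed.

Lemma bernoulli (x : R) n : 0 <= x -> 1 + n%:R * x <= (1 + x) ^+ n.
Proof.
move=> x0; elim: n => [|n IH]; first by rewrite mul0r addr0 expr0.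
rewrite exprS -natr1; have := ler_wpM2l (addr_ge0 ler01 x0) IH.
have : 0 <= n%:R * x ^+ 2 by rewrite mulr_ge0 ?exprn_ge0.
by nra.
Qed.

(** By Bernoulli, [round_factor * r] rounds at least double the potential because [round_factor]
    exceeds [16 / theta]; [(trunc_log 2 r).+1] doublings exceed [r]. *)
Lemma rounds_growth r : (0 < r)%N -> r%:R <= (1 + (16 * r%:R)^-1 * theta) ^+ (rounds r).+1.
Proof.
move=> r0; have rR : 0 < r%:R :> R by rewrite ltr0n.
have t0 := theta_gt0; have t0' := ltW t0; set q := 1 + _.
have q1 : 1 <= q by rewrite lerDl; apply: mulr_ge0 => //; rewrite invr_ge0 mulr_ge0.
apply: (@le_trans _ _ (q ^+ rounds r)); last by rewrite ler_weXn2l // leqnSn.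
have two : 2 <= q ^+ (round_factor * r).
  apply: le_trans (bernoulli _ _); last by rewrite -(lerDl 1).
  have := truncnS_gt (16 / theta); rewrite -/round_factor ltr_pdivrMr // natrM.
  move: round_factor%:R => k hk.
  rewrite [X in _ <= 1 + X](_ : _ = k * theta / 16); last by field; rewrite lt0r_neq0.
  lra.
rewrite /rounds exprM; apply: (@le_trans _ _ (2 ^+ (trunc_log 2 r).+1)).
  by rewrite -natrX ler_nat ltnW // trunc_log_ltn.
by apply: lerXn2r; rewrite ?nnegrE // (le_trans _ two).
Qed.

End SearchConstants.

Section Quality.
Variables (R : realType) (eps : R) (T : finType) (f ell : {set T} -> R) (M : matroid T).
Hypotheses (eps_gt0 : 0 < eps) (f_ge0 : setfun_nonneg f) (f_mono : setfun_monotone f)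
  (f_sub : setfun_submodular f) (ell_lin : setfun_linear ell).

Lemma greedy_is_base : is_base M (greedy M (enum T)).
Proof.
have [||//] := @greedy_max _ M R (fun=> 0) (enum T); first by move=> x; rewrite mem_enum.
by case: (enum T) => //= x s; elim: s x => //= y s IH x; rewrite IH lexx.
Qed.

Lemma rank_ofE : rank_of M = mrank M.
Proof.
have [gI gm] := greedy_is_base; apply/eqP; rewrite eqn_leq; apply/andP; split.
  exact: (leq_bigmax_cond _ gI).
by apply/bigmax_leqP => X XI; apply: gm.
Qed.

Lemma mrank_le : (mrank M <= #|T|)%N.
Proof. by apply/bigmax_leqP => X _; apply: max_card. Qed.

Lemma card_le_mrank S : S \in indep M -> (#|S| <= mrank M)%N.
Proof. by move=> Si; apply: (leq_bigmax_cond _ Si). Qed.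

Local Notation L := (parts eps).
Local Notation a := (alpha eps).
Local Notation r := (mrank M).
Local Notation N := (ext_matroid M L r).
Local Notation A0 := (greedy N (by_weight L ell)).
Local Notation wt := (weight ell).
Local Notation pot A := (Psi a ell f A - \sum_(x in A0) wt x).

Lemma start_base : is_base N A0 /\
  forall O, is_base N O -> \sum_(x in O) wt x <= \sum_(x in A0) wt x.
Proof.
apply: greedy_max; first by move=> x; rewrite mem_sort mem_enum.
by apply: sort_sorted => x y; apply: le_total.
Qed.

Variables (W : finType) (pick : nat -> W -> {set elt T L} -> seq (elt T L) * seq (elt T L)).
Hypotheses (W_gt0 : (0 < #|W|)%N)
  (pick_fair : (0 < r)%N -> fair_pick R r (pick r))
  (pick_sub : forall w (A : {set elt T L}), {subset (pick r w A).1 <= A}).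

Local Notation step w A := (round a ell f M r A (pick r w A).1 (pick r w A).2).
Local Notation run := (loop a ell pick f M r).

Lemma run_ge n A ws : value ell f A <= (run n A ws).2.
Proof. by case: n ws => [|n] [|w ws] //=; case: ifPn => //=; rewrite -ltNge; apply: ltW. Qed.

Lemma run_step n A w ws : (run n (step w A) ws).2 <= (run n.+1 A (w :: ws)).2.
Proof. by rewrite /=; case: ifP. Qed.

Lemma run_sound n A ws : is_base N A ->
  (run n A ws).1 \in indep M /\ (run n A ws).2 = f (run n A ws).1 + ell (run n A ws).1.
Proof.
elim: n A ws => [|n IH] A [|w ws] bA /=; try by split=> //; apply: ext_underlyingP bA.1.
have [bA' _ _] := round_spec ell f_mono f_sub (alpha_ge0 eps_gt0) (pick r w A).2 bA (@pick_sub w A).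
by case: ifP => _; [split=> //; apply: ext_underlyingP bA.1 | apply: IH].
Qed.

Lemma pot_le A : is_base N A -> pot A <= potential f a A.
Proof.
by move=> /start_base.2 le_A; rewrite /Psi -addrA gerDl subr_le0.
Qed.

(** A fair choice realizes on average a fraction [1 / (16 * r)] of the total swap gain, which
    [exchange_gain] bounds from below. *)
Lemma pot_step A S : (0 < r)%N -> S \in indep M -> is_base N A ->
  (16 * r%:R)^-1 * (coef_ratio (eps / 2) L * f S + ell S - value ell f A + theta eps * pot A) <=
  mean (fun w => pot (step w A)) - pot A.
Proof.
move=> r0 Si bA; have a0 := alpha_ge0 eps_gt0.
have d0 : 0 <= eps / 2 by rewrite divr_ge0 // ltW.
have t0 := theta_gt0 eps_gt0.
have [O [p [p1 p2 p3 gain]]] := exchange_gain f_ge0 f_mono f_sub a0 (ltn0Sn _)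
  (coef_rec d0 (ltn0Sn _)) (coef_top _ d0) (coef_weighted_sum _ d0) ell_lin
  mrank_le bA Si (card_le_mrank Si).
(* Losing swaps count as 0, which is legitimate since a round never decreases [Psi]. *)
pose y v := Num.max 0 (gain_in a ell f A v - gain_out a ell f A (p v)).
have cA : #|A| = r by apply: ext_base_card mrank_le (ltn0Sn _) bA.
have rs w := round_spec ell f_mono f_sub a0 (pick r w A).2 bA (@pick_sub w A).
pose G w := Psi a ell f (step w A) - Psi a ell f A.
have fair := pick_fair r0 (y := y) (G := G) cA p1 p2.
have mG : mean G = mean (fun w => pot (step w A)) - pot A.
  rewrite -[pot A](@mean_cst _ W) // -[X in _ = _ + X]mulN1r -meanZ -meanD.
  by rewrite /mean; congr (_ / _); apply: eq_bigr => w _; rewrite /G; ring.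
rewrite -mG; apply: le_trans (fair _ _ _); first last.
- move=> w v vO pv vw; rewrite /y ge_max; have [_ le_w H] := rs w.
  by rewrite /G subr_ge0 le_w; apply: H => //; apply: p3.
- by move=> w; rewrite /G subr_ge0; have [] := rs w.
- by move=> v; rewrite le_max lexx.
rewrite ler_wpM2l ?invr_ge0 ?mulr_ge0 //.
apply: (@le_trans _ _ (\sum_(v in O) (gain_in a ell f A v - gain_out a ell f A (p v)))); last first.
  by apply: ler_sum => v _; rewrite le_max lexx orbT.
apply: le_trans gain; rewrite /value.
(* The slack between the coefficients 1 and [(1 + eps / 2)^-1] of [f (underlying A)] pays for the
   growth term. *)
have h : theta eps * pot A <= (1 - (1 + eps / 2)^-1) * f (underlying A).
  apply: le_trans (ler_wpM2l (ltW t0) (le_trans (pot_le bA) (potential_le f_mono a0 A))) _.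
  rewrite mulrA ler_wpM2r // /theta -/(coef_total eps).
  have ct := coef_total_ge0 eps_gt0.
  rewrite mulrAC ler_pdivrMr ?ltr_pwDl // ler_wpM2l ?lerDr //.
  by rewrite subr_ge0 invf_le1 ?lerDl // ltr_pwDl.
by move: (theta eps * _) h => z; move: (1 + eps / 2)^-1 => c; lra.
Qed.

Lemma result_indep ws : result a ell pick (rounds eps) f M ws \in indep M.
Proof.
rewrite /result rank_ofE; case: ifP => _; first exact: indep_set0.
have [b1 _ _] := first_round_spec ell f_ge0 f_mono (alpha_ge0 eps_gt0) start_base.1.
by have [] := run_sound (rounds eps r) ws b1.
Qed.

Lemma result_quality m S : S \in indep M -> (rounds eps r <= m)%N ->
  (1 - 1 / expR 1 - eps) * f S + ell S <=
  mean (fun s : seeds W m => let X := result a ell pick (rounds eps) f M (seed_seq s) in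
          f X + ell X).
Proof.
move=> Si le_m; rewrite /result rank_ofE; case: posnP => [rz|r0].
  have -> : S = set0 by apply/eqP; rewrite -cards_eq0 -leqn0 -rz card_le_mrank.
  rewrite (@mean_cst _ (seeds W m)) ?card_seeds_gt0 // lerD2r ler_piMl //.
  by rewrite -addrA gerDl -opprD oppr_le0 addr_ge0 ?divr_ge0 ?expR_ge0 // ltW.
set A1 := first_round _ _ _ _ _ _.
have a0 := alpha_ge0 eps_gt0.
have [b1 p1 _] := first_round_spec ell f_ge0 f_mono a0 start_base.1.
rewrite -/A1 in b1 p1.
rewrite [X in _ <= X](_ : _ = mean (fun s : seeds W m => (run (rounds eps r) A1 (seed_seq s)).2));
  last first.
  by congr (_ / _); apply: eq_bigr => s _; have [_ ->] := run_sound (rounds eps r) (seed_seq s) b1.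
apply: (@le_trans _ _ (coef_ratio (eps / 2) L * f S + ell S)).
  rewrite lerD2r ler_wpM2r // coef_ratio_ge //; apply: ltW.
  exact: truncnS_gt.
have rho0 : 0 < (16 * r%:R)^-1 :> R by rewrite invr_gt0 mulr_gt0 ?ltr0n.
(* The bound [r * pot A1] on all potentials comes from [first_round_max]; the process only has to
   grow by a factor [r]. *)
apply: (@mean_best R W _ (is_base N) (fun w A => step w A) (value ell f) (fun A => pot A)
  (fun n A ws => (run n A ws).2) (16 * r%:R)^-1 (theta eps) _ (r%:R * pot A1)) => //.
- exact: ltW (theta_gt0 eps_gt0).
- by move=> *; apply: run_ge.
- by move=> *; apply: run_step.
- move=> w A bA.
  by have [] := round_spec ell f_mono f_sub a0 (pick r w A).2 bA (@pick_sub w A).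
- move=> O bO; apply: first_round_max => //; first exact: mrank_le.
  exact: start_base.1.
- by move=> A; apply: pot_step.
- by rewrite ler_wpM2r // rounds_growth.
Qed.

End Quality.

(** * Number of queries *)

Definition cost_factor (L C K c : nat) := (K * (c * C + 2 * c) + 2 * L * (C + 3) + 2)%N.

(** Here [t] stands for the logarithm of [n]; one factor [t] comes from the number of rounds and one
    from the binary searches. [Q] is the target bound without logarithms, [C] the number of color
    sets, and [b], [c] bound the candidates of a round. *)
Lemma total_cost (n L C K r t t' b c D D' k Q : nat) :
  (n <= Q)%N -> (0 < Q)%N -> (t' <= t)%N -> (0 < t)%N -> (D <= 2 * t)%N -> (D' <= 2 * t)%N ->
  (r * (b + c).+1 <= k * Q)%N ->
  (n + (n * 2 * L + (n * 2 * L * C + n * 2 * L * D) +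
    (K * r * t' * ((b + c).+1 * C + c * D') + 1)) <= cost_factor L C K k * (Q * t ^ 2))%N.
Proof.
move=> nQ Q0 t't t0 Dt D't rk.
have tt : (t <= t * t)%N by rewrite leq_pmulr.
have QX : (Q <= Q * t ^ 2)%N by rewrite leq_pmulr // expn_gt0 t0.
have nt : (n * t <= Q * t ^ 2)%N by rewrite leq_mul // -mulnn.
have h1 : (n * 2 * L * C <= 2 * L * C * (Q * t ^ 2))%N.
  by rewrite [(n * 2 * L * C)%N](_ : _ = (2 * L * C * n)%N) ?leq_mul // ?(leq_trans nQ) //; lia.
have h2 : (n * 2 * L * D <= 4 * L * (Q * t ^ 2))%N.
  apply: (@leq_trans (4 * L * (n * t))); last by rewrite leq_mul2l nt orbT.
  by apply: leq_trans (leq_mul (leqnn _) Dt) _; lia.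
have h3 : (n * 2 * L <= 2 * L * (Q * t ^ 2))%N.
  by rewrite [(n * 2 * L)%N](_ : _ = (2 * L * n)%N) ?leq_mul // ?(leq_trans nQ) //; lia.
have h4 : (r * t' * ((b + c).+1 * C) <= k * C * (Q * t ^ 2))%N.
  have : (r * (b + c).+1 * (t' * C) <= k * Q * (t ^ 2 * C))%N.
    by rewrite leq_mul // leq_mul2r (leq_trans t't) ?orbT // -mulnn.
  move=> h; rewrite [X in (X <= _)%N](_ : _ = (r * (b + c).+1 * (t' * C))%N); last lia.
  by rewrite (leq_trans h) //; lia.
have h5 : (r * t' * (c * D') <= 2 * k * (Q * t ^ 2))%N.
  have rc : (r * c <= k * Q)%N by apply: leq_trans rk; rewrite leq_mul2l; lia.
  have h : (r * c * (t' * D') <= k * Q * (t * (2 * t)))%N by apply: leq_mul => //; apply: leq_mul.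
  by rewrite [X in (X <= _)%N](_ : _ = (r * c * (t' * D'))%N) ?(leq_trans h) //; lia.
have h6 : (K * r * t' * ((b + c).+1 * C + c * D') <= K * (k * C + 2 * k) * (Q * t ^ 2))%N.
  rewrite -!mulnA leq_mul2l mulnA [(r * t' * _)%N]mulnDr mulnDl.
  by rewrite leq_add ?orbT.
have X0 : (0 < Q * t ^ 2)%N by apply: leq_trans QX.
have nX := leq_trans nQ QX.
move: (Q * t ^ 2)%N h1 h2 h3 h6 X0 nX => X h1 h2 h3 h6 X0 nX.
rewrite /cost_factor !mulnDl; lia.
Qed.

Section QueryBounds.
Variables (R : realType).

(** The factor 2 reflects [1 / 2 <= ln 2], which follows from [1 / 2 <= expR (- 1 / 2)]. *)
Lemma log_bound n : (trunc_log 2 n).+1%:R <= 2 * (1 + ln n%:R) :> R.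
Proof.
case: n => [|n]; first by rewrite trunc_log0 ln0 // addr0 mulr1 ler1n.
have half : 2^-1 <= ln 2 :> R.
  rewrite -ler_expR lnK ?posrE // -[X in X <= _]invrK -[X in _ <= X]invrK.
  rewrite lef_pV2 ?posrE ?invr_gt0 ?expR_gt0 // -expRN.
  by have := @expR_ge1Dx R (- 2^-1); lra.
have : (trunc_log 2 n.+1)%:R * ln 2 <= ln n.+1%:R :> R.
  rewrite mulrC mulr_natr -lnXn // ler_ln ?posrE ?exprn_gt0 // -natrX ler_nat.
  exact: trunc_logP.
have : (trunc_log 2 n.+1)%:R * 2^-1 <= (trunc_log 2 n.+1)%:R * ln 2 :> R by rewrite ler_wpM2l.
by move=> h1 h2; rewrite -[X in X <= _]natr1; lra.
Qed.

Lemma polylog_bound (x F Q n : nat) : (x <= F * (Q * (trunc_log 2 n).+1 ^ 2))%N ->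
  x%:R <= (4 * F)%:R * Q%:R * polylog R 2 n.
Proof.
move=> xF; apply: (@le_trans _ _ (F%:R * Q%:R * (trunc_log 2 n).+1%:R ^+ 2)).
  by rewrite -natrX -!natrM ler_nat -mulnA.
rewrite /polylog natrM.
have := log_bound n; have : 0 <= (trunc_log 2 n).+1%:R :> R by [].
move: (trunc_log 2 n).+1%:R (1 + _) => t l t0 tl.
have : t ^+ 2 <= (2 * l) ^+ 2 by apply: lerXn2r; rewrite ?nnegrE // (le_trans t0).
rewrite exprMn => h; have := ler_wpM2l (mulr_ge0 (ler0n R F) (ler0n R Q)) h; lra.
Qed.

Variables (eps : R) (T : finType) (f ell : {set T} -> R) (M : matroid T).
Variables (W : Type) (pick : nat -> W -> {set elt T (parts eps)} ->
  seq (elt T (parts eps)) * seq (elt T (parts eps))).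
Local Notation L := (parts eps).
Local Notation r := (mrank M).
Local Notation C := #|{set 'I_L}|.

Lemma card_elt : #|{: elt T L}| = (#|T| * 2 * L)%N.
Proof. by rewrite !card_prod card_bool card_ord. Qed.

Lemma query_bound (b c k Q : nat) ws : (#|T| <= Q)%N -> (b <= r)%N ->
  ((0 < r)%N -> (r * (b + c).+1 <= k * Q)%N) ->
  (forall w A, (size (pick r w A).1 <= b)%N /\ (size (pick r w A).2 <= c)%N) ->
  (queries f M (local_search (alpha eps) ell pick (rounds eps) ws) <=
    cost_factor L C (round_factor eps) k * (Q * (trunc_log 2 #|T|).+1 ^ 2))%N.
Proof.
move=> nQ br rk le_pick; rewrite -(rank_ofE R M) in le_pick.
apply: leq_trans (queries_local_search _ _ _ _ _ le_pick) _.
rewrite (rank_ofE R M) card_elt; case: posnP => [r0|r0].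
  rewrite mul0n addn0 (leq_trans nQ) // /cost_factor.
  by apply: (@leq_trans (2 * (Q * (trunc_log 2 #|T|).+1 ^ 2))); nia.
rewrite mul1n (ext_base_card (mrank_le M) _ (start_base eps ell M).1) //.
have n0 : (0 < #|T|)%N by apply: leq_trans r0 (mrank_le M).
have le_log m : (m <= r)%N -> (trunc_log 2 m <= trunc_log 2 #|T|)%N.
  by move=> mr; apply: leq_trunc_log; apply: leq_trans mr (mrank_le M).
have le_depth m : (m <= r)%N -> (depth m <= 2 * (trunc_log 2 #|T|).+1)%N.
  by move=> /le_log; rewrite /depth; lia.
have Q0 := leq_trans n0 nQ.
have t_le : (trunc_log 2 r < (trunc_log 2 #|T|).+1)%N by rewrite ltnS le_log.
exact: total_cost nQ Q0 t_le (ltn0Sn _) (le_depth _ (leqnn _)) (le_depth _ br) (rk r0).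
Qed.

End QueryBounds.

(** If the block size is [r], then [r] times the number of draws is at most [m]. Otherwise it is
    [s], the integer root of [m], and [m < (s + 1) ^ 2] leaves at most [3 * s] draws. *)
Lemma sample_size_bound (E : finType) (n L r : nat) : #|E| = (n * 2 * L)%N ->
  (0 < L)%N -> (0 < r)%N -> (r <= n)%N ->
  (r * (block_size E r + draws E r).+1 <=
    (3 * L + 5) * (n + r * isqrt #|{: option E}|))%N.
Proof.
move=> cE L0 r0 rn; have cm : #|{: option E}| = (n * 2 * L).+1 by rewrite card_option cE.
have := isqrt_spec #|{: option E}|; have b0 := block_size_gt0 E r0.
rewrite /draws /block_size in b0 *; move: (isqrt _) b0 => s b0.
move: #|{: option E}| cm => m cm /andP[sm ms].
have s0 : (0 < s)%N by case: s ms {sm b0} => //; rewrite cm; nia.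
have bs : (r * minn r s <= r * s)%N by rewrite leq_mul2l geq_minr orbT.
have rc : (r * (m %/ minn r s) <= m + 3 * (r * s))%N.
  case: (leqP r s) => rs.
    by rewrite mulnC (leq_trans (leq_trunc_div _ _)) // leq_addr.
  have : (m %/ s <= 3 * s)%N.
    by rewrite -(mulnK (3 * s) s0); apply: leq_div2r; nia.
  by move=> h; rewrite (leq_trans (leq_mul (leqnn r) h)) //; lia.
have rs : (r <= r * s)%N by rewrite leq_pmulr.
have mL : (m <= 3 * L * n)%N by rewrite cm; nia.
set b := minn r s in bs rc *; set c := (m %/ b)%N in rc *.
by rewrite mulnS mulnDr; move: bs rc rs; rewrite mulnDl !mulnDr; move: (r * s)%N => q; lia.
Qed.

Lemma isqrt_le_sqrt (R : realType) (n L m : nat) : (m = (n * 2 * L).+1)%N -> (0 < L)%N ->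
  (0 < n)%N -> (isqrt m)%:R <= (3 * L)%:R * Num.sqrt n%:R :> R.
Proof.
move=> mE L0 n0; have /andP[sm _] := isqrt_spec m.
have h : (isqrt m)%:R ^+ 2 <= (3 * L)%:R ^+ 2 * n%:R :> R.
  rewrite -!natrX -natrM ler_nat -mulnn (leq_trans sm) // mE -mulnn; nia.
rewrite -[X in X <= _]ger0_norm // -sqrtr_sqr -[X in _ <= X * _]ger0_norm // -sqrtr_sqr.
by rewrite -sqrtrM ?exprn_ge0 // ler_wsqrtr.
Qed.

(** * The two algorithms *)

Lemma uniform_sum1 (R : realType) (W : finType) : (0 < #|W|)%N ->
  \sum_(w : W) #|W|%:R^-1 = 1 :> R.
Proof. by move=> W0; rewrite sumr_const -[_ *+ _]mulr_natr mulVf // pnatr_eq0 -lt0n. Qed.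

Lemma uniform_ge0 (R : realType) (W : finType) : W -> 0 <= #|W|%:R^-1 :> R.
Proof. by rewrite invr_ge0. Qed.

Definition uniform_alg (R : realType) (T W : finType) (W0 : (0 < #|W|)%N)
    (alg : W -> det_alg R T) : rand_alg R T :=
  RandAlg (@uniform_ge0 R W) (uniform_sum1 R W0) alg.

Lemma sample_seed_gt0 (E : finType) : (0 < #|sample_seed E|)%N.
Proof. by rewrite card_prod muln_gt0 card_seeds_gt0 card_option. Qed.

Definition det_local_search (R : realType) (T : finType) (eps : R) (ell : {set T} -> R) :=
  local_search (alpha eps) ell (@full_pick (elt T (parts eps))) (rounds eps)
    (nseq (rounds eps #|T|) tt).

Definition rand_local_search (R : realType) (T : finType) (eps : R) (ell : {set T} -> R) :=
  uniform_alg (card_seeds_gt0 (rounds eps #|T|) (sample_seed_gt0 (elt T (parts eps))))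
    (fun s => local_search (alpha eps) ell (@sample_pick (elt T (parts eps))) (rounds eps)
      (seed_seq s)).

(* The query bound of the deterministic algorithm reads n * max(r, 1): no
   algorithm can recognize rank 0 without making queries. *)
Theorem theoremA1 (R : realType) :
  (exists (alg : forall T : finType, R -> ({set T} -> R) -> det_alg R T)
          (k : nat),
    forall eps : R, 0 < eps ->
    exists C : R,
    forall (T : finType) (f ell : {set T} -> R) (M : matroid T),
      setfun_nonneg f -> setfun_monotone f -> setfun_submodular f ->
      setfun_linear ell ->
      let a := alg T eps ell in
      let S := output f M a in
      [/\ S \in indep M,
          forall OPT : {set T}, OPT \in indep M ->
            (1 - 1 / expR 1 - eps) * f OPT + ell OPT <= f S + ell S
        & (queries f M a)%:R
            <= C * (#|T| * maxn (mrank M) 1)%:R * polylog R k #|T|])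
  /\
  (exists (alg : forall T : finType, R -> ({set T} -> R) -> rand_alg R T)
          (k : nat),
    forall eps : R, 0 < eps ->
    exists C : R,
    forall (T : finType) (f ell : {set T} -> R) (M : matroid T),
      setfun_nonneg f -> setfun_monotone f -> setfun_submodular f ->
      setfun_linear ell ->
      let a := alg T eps ell in
      let S := fun w : seed a => output f M (seed_alg w) in
      [/\ forall w : seed a, S w \in indep M,
          forall OPT : {set T}, OPT \in indep M ->
            (1 - 1 / expR 1 - eps) * f OPT + ell OPT
              <= expectation (fun w : seed a => f (S w) + ell (S w))
        & forall w : seed a,
            (queries f M (seed_alg w))%:R
              <= C * (#|T|%:R + (mrank M)%:R * Num.sqrt #|T|%:R)
                 * polylog R k #|T|]).
Proof.
have rounds_mono (eps : R) (T : finType) (M : matroid T) :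
    (rounds eps (mrank M) <= rounds eps #|T|)%N.
  have le := mrank_le M; rewrite /rounds leq_mul ?leq_mul // ltnS.
  exact: leq_trunc_log.
split.
  exists (fun T eps ell => det_local_search eps ell), 2 => eps eps_gt0.
  (* A round has [r] candidates to remove and [2 * n * L] to add, and [r + 1 <= 2 * n] when the rank
     is positive. *)
  pose k := (2 + 2 * parts eps)%N.
  exists (4 * cost_factor (parts eps) #|{set 'I_(parts eps)}| (round_factor eps) k)%:R.
  move=> T f ell M f_ge0 f_mono f_sub ell_lin a S.
  have SE : S = result (alpha eps) ell (@full_pick (elt T (parts eps))) (rounds eps) f M
      (nseq (rounds eps #|T|) tt).
    by rewrite /S /a /det_local_search output_local_search.
  have fair : (0 < mrank M)%N -> fair_pick R (mrank M) (@full_pick (elt T (parts eps)) (mrank M)).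
    by move=> _; apply: full_pick_fair.
  have sub w (A : {set elt T (parts eps)}) : {subset (full_pick (mrank M) w A).1 <= A}.
    by move=> x /mem_take; rewrite mem_enum.
  have W0 : (0 < #|{: unit}|)%N by rewrite card_unit.
  split.
  - by rewrite SE; apply: result_indep.
  - move=> OPT OPT_indep.
    have := result_quality eps_gt0 f_ge0 f_mono f_sub ell_lin W0 fair sub OPT_indep
      (rounds_mono eps T M).
    (* There is only one sequence of [unit] seeds of a given length, so the mean is the value of the
       deterministic output. *)
    rewrite (_ : mean _ = f S + ell S) // SE.
    rewrite -[RHS](@mean_cst R (seeds unit (rounds eps #|T|))) ?card_seeds_gt0 //.
    rewrite /mean; congr (_ / _); apply: eq_bigr => s _.
    have -> // : seed_seq s = nseq (rounds eps #|T|) tt.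
    by elim: (rounds _ _) s => //= m IH [[] s]; rewrite IH.
  - apply: polylog_bound.
    apply: (@query_bound R eps T f ell M _ _ (mrank M) #|{: elt T (parts eps)}|).
    + by rewrite leq_pmulr // leq_max orbT.
    + by [].
    + move=> r0; have := mrank_le M; rewrite card_elt (maxn_idPl r0) /k; nia.
    + move=> w A; rewrite -cardE; split=> //.
      by rewrite size_take_min geq_minl.
exists (fun T eps ell => rand_local_search eps ell), 2 => eps eps_gt0.
pose L := parts eps; pose k := (3 * L + 5)%N.
(* The last factor comes from comparing the integer root of [2 * n * L + 1] with the square root of
   [n]. *)
exists ((4 * cost_factor L #|{set 'I_L}| (round_factor eps) k)%:R * (3 * L)%:R).
move=> T f ell M f_ge0 f_mono f_sub ell_lin a S.
have SE w : S w = result (alpha eps) ell (@sample_pick (elt T L)) (rounds eps) f M (seed_seq w).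
  by rewrite /S /= output_local_search.
have cE : #|{: elt T L}| = (#|T| * 2 * L)%N := card_elt _ _.
have fair : (0 < mrank M)%N -> fair_pick R (mrank M) (@sample_pick (elt T L) (mrank M)).
  move=> r0; apply: sample_pick_fair => //; rewrite cE.
  by apply: leq_trans (mrank_le M) _; rewrite -mulnA leq_pmulr.
have sub w (A : {set elt T L}) : {subset (sample_pick (mrank M) w A).1 <= A}.
  by move=> x /mem_take /mem_drop; rewrite mem_enum.
have W0 := sample_seed_gt0 (elt T L).
split.
- by move=> w; rewrite SE; apply: result_indep.
- move=> OPT OPT_indep.
  have := result_quality eps_gt0 f_ge0 f_mono f_sub ell_lin W0 fair sub OPT_indep
    (rounds_mono eps T M).
  move/le_trans; apply; rewrite /mean /expectation mulr_suml le_eqVlt; apply/orP; left.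
  by apply/eqP; apply: eq_bigr => w _; rewrite SE mulrC.
- move=> w; pose s := isqrt #|{: option (elt T L)}|.
  have bound : (queries f M (seed_alg w) <= cost_factor L #|{set 'I_L}| (round_factor eps) k *
      ((#|T| + mrank M * s) * (trunc_log 2 #|T|).+1 ^ 2))%N.
    apply: (@query_bound R eps T f ell M _ _ (block_size (elt T L) (mrank M))
      (draws (elt T L) (mrank M))).
    + exact: leq_addr.
    + exact: geq_minl.
    + by move=> r0; apply: sample_size_bound => //; apply: mrank_le.
    + move=> v A /=; split; first by rewrite size_take_min geq_minl.
      by rewrite size_pmap (leq_trans (count_size _ _)) // size_take_min geq_minl.
  apply: le_trans (polylog_bound R bound) _.
  rewrite ler_wpM2r ?sqr_ge0 //.
  rewrite -mulrA ler_wpM2l // natrD natrM mulrDr lerD //.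
    by rewrite ler_peMl // ler1n.
  case: (posnP (mrank M)) => [->|r0]; first by rewrite !mul0r mulr0.
  rewrite mulrCA ler_wpM2l //; apply: isqrt_le_sqrt => //.
    by rewrite card_option cE.
  exact: leq_trans r0 (mrank_le M).
Qed.
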